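(* Let $f\in\mathscr{B}^\infty_{c,T}$, where $c\in\mathbb{R}$ and $T>0$. Then $$(\widetilde{\Theta}_cf)(r,\theta)=\frac{T}{2}\left[e^{\pi c/(2T)}f(re^{\pi/(2T)},\theta)-e^{-\pi c/(2T)}f(re^{-\pi/(2T)},\theta)\right]+\frac{T}{\pi}\sum_{k\in\mathbb{Z}\setminus\{0\}}\frac{(-1)^ke^{k\pi c/T}f(re^{k\pi/T},\theta)}{k(4k^2-1)}$$ for $(r,\theta)\in\mathbb{H}$. Multiplied by $r^c$, the series converges absolutely and uniformly on strips of bounded width parallel to the $r$-axis in $\mathbb{H}$ (that is, on sets $\{(r,\theta)\in\mathbb{H}: a\le\theta\le b\}$ with $a<b$ real).
   Context: $\mathbb{H}:=\{(r,\theta): r\in\mathbb{R}^+,\ \theta\in\mathbb{R}\}$ with $\mathbb{R}^+=(0,\infty)$. A function $f:\mathbb{H}\to\mathbb{C}$ is polar-analytic on $\mathbb{H}$ if for every $(r_0,\theta_0)\in\mathbb{H}$ the limit $$(D_{\rm pol}f)(r_0,\theta_0):=\lim_{(r,\theta)\to(r_0,\theta_0)}\frac{f(r,\theta)-f(r_0,\theta_0)}{re^{i\theta}-r_0e^{i\theta_0}}$$ exists. The polar Mellin derivative is $(\widetilde{\Theta}_cf)(r,\theta):=re^{i\theta}(D_{\rm pol}f)(r,\theta)+c f(r,\theta)$. The Mellin--Bernstein space $\mathscr{B}^\infty_{c,T}$ ($c\in\mathbb{R}$, $T>0$) consists of all $f:\mathbb{H}\to\mathbb{C}$ such that (i) $f$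 is polar-analytic on $\mathbb{H}$; (ii) $f(\cdot,0)\in X_c^\infty$, i.e. $\sup_{r>0}r^c|f(r,0)|<\infty$; (iii) there is a constant $C_f>0$ with $r^c|f(r,\theta)|\le C_fe^{T|\theta|}$ for all $(r,\theta)\in\mathbb{H}$. *)

(* Defs.v *)
From Stdlib Require Export Reals ZArith.
From Coquelicot Require Export Coquelicot.
Set Implicit Arguments.
Unset Strict Implicit.
Unset Printing Implicit Defensive.
Open Scope R_scope.

(* A function on H = {(r, t) : 0 < r} is a total curried function
   [R -> R -> C]; its values at r <= 0 are never used, since every notion below
   is restricted to r > 0 and H is open (so limits at points of H only see H). *)

(* The point r e^(i t). *)
Definition polar (r t : R) : C := (RtoC r * (cos t, sin t))%C.

(* (r, t) tends to (r0, t0) in the plane of polar coordinates: t is not taken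
   modulo 2 pi, and the denominator vanishes near (r0, t0) only at (r0, t0). *)
Definition is_Dpol (f : R -> R -> C) (r0 t0 : R) (l : C) : Prop :=
  filterlim
    (fun p : R * R =>
       ((f (fst p) (snd p) - f r0 t0)
        / (polar (fst p) (snd p) - polar r0 t0))%C)
    (locally' ((r0, t0) : R * R)) (locally l).

(* As [iota] is total, this is meaningful only where the limit exists. *)
Definition Dpol (f : R -> R -> C) (r t : R) : C :=
  iota (T := C_R_CompleteNormedModule) (is_Dpol f r t).

Definition polar_analytic (f : R -> R -> C) : Prop :=
  forall r t : R, 0 < r -> exists l : C, is_Dpol f r t l.

Definition Theta (c : R) (f : R -> R -> C) (r t : R) : C :=
  (polar r t * Dpol f r t + RtoC c * f r t)%C.

Definition X_infty (c : R) (g : R -> C) : Prop :=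
  bound (fun y : R => exists r : R, 0 < r /\ y = Rpower r c * Cmod (g r)).

Definition Mellin_Bernstein (c T : R) (f : R -> R -> C) : Prop :=
  polar_analytic f
  /\ X_infty c (fun r => f r 0)
  /\ exists Cf : R, 0 < Cf /\
       forall r t : R, 0 < r ->
         Rpower r c * Cmod (f r t) <= Cf * exp (T * Rabs t).

(* Sum of a k over -m <= k <= n with k <> 0. *)
Definition zsum {G : AbelianMonoid} (a : Z -> G) (m n : nat) : G :=
  plus (sum_n_m (fun j => a (- Z.of_nat j)%Z) 1 m)
       (sum_n_m (fun j => a (Z.of_nat j)) 1 n).

(* Series over the nonzero integers: the two bounds tend to infinity
   independently. *)
Definition is_zseries {K : AbsRing} {V : NormedModule K} (a : Z -> V) (l : V)
  : Prop :=
  filterlim (fun mn : nat * nat => zsum a (fst mn) (snd mn))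
    (filter_prod eventually eventually) (locally l).

Definition zseries_cv_abs_on {X : Type} (E : X -> Prop) (u : Z -> X -> C)
  : Prop :=
  forall x : X, E x ->
    exists l : R,
      is_zseries (V := R_NormedModule) (fun k => Cmod (u k x)) l.

Definition zseries_cv_unif_on {X : Type} (E : X -> Prop) (u : Z -> X -> C)
  : Prop :=
  exists S : X -> C,
    forall eps : R, 0 < eps ->
      exists N : nat, forall m n : nat, (N <= m)%nat -> (N <= n)%nat ->
        forall x : X, E x ->
          Cmod (zsum (G := C_AbelianMonoid) (fun k => u k x) m n - S x)%C < eps.

Definition strip (a b : R) (p : R * R) : Prop :=
  0 < fst p /\ a <= snd p <= b.

Definition series_term (c T : R) (f : R -> R -> C) (k : Z) (r t : R) : C :=
  (RtoC (powerRZ (-1) k * exp (IZR k * PI * c / T))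
   * f (r * exp (IZR k * PI / T))%R t
   / RtoC (IZR (k * (4 * k ^ 2 - 1))))%C.

(* Main.v *)
(* In the coordinates z = ln r + i t the function e^(c z) f becomes an entire
   function, of derivative e^(c z) Theta_c f and of growth e^(T |Im z|). After
   a translation, a dilation and the subtraction of a constant we get an entire
   h with h(0) = 0 and |h(w)| <= A e^(pi |Im w|). The formula is then the sum
   of the residues of h(w) / (w (4 w^2 - 1) sin(pi w)) at 0, at +-1/2 and at the
   nonzero integers: on the boundary of the box
   [-N-3/4, N+3/4] x [-N, N] the sine dominates e^(pi |Im w|), so that the
   contour integral is O(1/N^2). The complex derivative is not assumed to be
   continuous, hence Goursat's bisection is needed for Cauchy's theorem. *)
Require Import Defs.
From Stdlib Require Import Lra Lia Psatz Classical ClassicalEpsilon.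
Set Implicit Arguments.
Unset Strict Implicit.
Open Scope R_scope.

(** * Complex limits and derivatives *)

(** The dilation by [PI / T] sends the nodes to the integers and brings the exponential type to
    exactly [PI], the growth of the sine. The quotient then has no exponential gain, so the decay on
    the contour must come from the polynomial: with [w] alone the estimate would only give
    boundedness. The factor [4 w^2 - 1] adds two powers, and its zeros produce the two half-step
    values of the formula. The denominator has a double zero at 0. Subtracting a constant makes [h]
    vanish there, so the pole becomes simple and its residue sees only [h'(0)]. The constant leaves
    no trace: it cancels in the difference of the values at [1/2] and [-1/2], and the weights of the
    series are odd. All poles being simple and real, the box is cut into vertical strips holding one
    pole each. Cuts at odd multiples of [1/4] avoid the integers and [1/2], [-1/2]; this is where
    [3/4] comes from. The contour reaches only the symmetric partial sums. Convergence with two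
    independent bounds comes separately from a majorant [M / k^2], and the symmetric sums merely
    identify the limit. *)

Definition Clim (f : C -> C) (z l : C) : Prop :=
  forall eps : R, 0 < eps -> exists d : R, 0 < d /\
    forall w : C, w <> z -> Cmod (w - z) < d -> Cmod (f w - l) < eps.

Definition Ccont (f : C -> C) (z : C) : Prop := Clim f z (f z).

(** At [w = z] the quotient has a default value, which the punctured limit never sees. *)
Definition Cderiv (f : C -> C) (z l : C) : Prop :=
  Clim (fun w => (f w - f z) / (w - z))%C z l.

Definition Choloc (f : C -> C) (z : C) : Prop := exists l, Cderiv f z l.

Lemma Cmod_sub_sym (z w : C) : Cmod (z - w) = Cmod (w - z).
Proof. rewrite <- Cmod_opp. f_equal. ring. Qed.

Lemma Clim_ext_loc (f g : C -> C) (z l : C) (d : R) :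
  0 < d -> (forall w, w <> z -> Cmod (w - z) < d -> f w = g w) ->
  Clim f z l -> Clim g z l.
Proof.
  intros hd he hf eps heps.
  destruct (hf eps heps) as [d' [hd' h]].
  exists (Rmin d d'); split; [now apply Rmin_pos|].
  intros w hw hwz.
  rewrite <- he; auto.
  - apply h; auto. eapply Rlt_le_trans; [exact hwz|apply Rmin_r].
  - eapply Rlt_le_trans; [exact hwz|apply Rmin_l].
Qed.

Lemma Clim_ext (f g : C -> C) (z l : C) :
  (forall w, w <> z -> f w = g w) -> Clim f z l -> Clim g z l.
Proof. intros he. apply (@Clim_ext_loc f g z l 1); [lra|auto]. Qed.

Lemma Clim_const (c z : C) : Clim (fun _ => c) z c.
Proof.
  intros eps heps. exists 1; split; [lra|]. intros w _ _.
  replace (c - c)%C with (RtoC 0) by ring. rewrite Cmod_0. exact heps.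
Qed.

Lemma Clim_id (z : C) : Clim (fun w => w) z z.
Proof. intros eps heps. exists eps; split; [exact heps|]. auto. Qed.

Lemma Clim_plus (f g : C -> C) (z l m : C) :
  Clim f z l -> Clim g z m -> Clim (fun w => f w + g w)%C z (l + m)%C.
Proof.
  intros hf hg eps heps.
  destruct (hf (eps / 2)) as [d1 [hd1 h1]]; [lra|].
  destruct (hg (eps / 2)) as [d2 [hd2 h2]]; [lra|].
  exists (Rmin d1 d2); split; [now apply Rmin_pos|].
  intros w hw hwz.
  assert (H1 := h1 w hw (Rlt_le_trans _ _ _ hwz (Rmin_l _ _))).
  assert (H2 := h2 w hw (Rlt_le_trans _ _ _ hwz (Rmin_r _ _))).
  replace (f w + g w - (l + m))%C with ((f w - l) + (g w - m))%C by ring.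
  eapply Rle_lt_trans; [apply Cmod_triangle|lra].
Qed.

Lemma Clim_mult (f g : C -> C) (z l m : C) :
  Clim f z l -> Clim g z m -> Clim (fun w => f w * g w)%C z (l * m)%C.
Proof.
  intros hf hg eps heps.
  (* With [e <= 1] the three error terms [e e + |l| e + e |m|] are at most [e K]; the factor 2 in
     [e] makes the final inequality strict. *)
  set (K := Cmod l + Cmod m + 1).
  assert (hl := Cmod_ge_0 l). assert (hm := Cmod_ge_0 m).
  assert (hK : 0 < K) by (unfold K; lra).
  set (e := Rmin 1 (eps / (2 * K))).
  assert (he : 0 < e).
  { apply Rmin_pos; [lra|]. apply Rdiv_lt_0_compat; lra. }
  assert (he1 : e <= 1) by apply Rmin_l.
  assert (he2 : e * (2 * K) <= eps).
  { replace eps with (eps / (2 * K) * (2 * K)) by (field; lra).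
    apply Rmult_le_compat_r; [lra|apply Rmin_r]. }
  destruct (hf e he) as [d1 [hd1 h1]].
  destruct (hg e he) as [d2 [hd2 h2]].
  exists (Rmin d1 d2); split; [now apply Rmin_pos|].
  intros w hw hwz.
  assert (H1 := h1 w hw (Rlt_le_trans _ _ _ hwz (Rmin_l _ _))).
  assert (H2 := h2 w hw (Rlt_le_trans _ _ _ hwz (Rmin_r _ _))).
  replace (f w * g w - l * m)%C
    with ((f w - l) * (g w - m) + (l * (g w - m) + (f w - l) * m))%C by ring.
  eapply Rle_lt_trans; [apply Cmod_triangle|].
  eapply Rle_lt_trans; [apply Rplus_le_compat_l, Cmod_triangle|].
  rewrite !Cmod_mult.
  assert (h0 := Cmod_ge_0 (f w - l)). assert (h0' := Cmod_ge_0 (g w - m)).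
  unfold K in *. nra.
Qed.

Lemma Clim_inv (f : C -> C) (z l : C) :
  l <> 0%C -> Clim f z l -> Clim (fun w => / f w)%C z (/ l)%C.
Proof.
  intros hl hf eps heps.
  assert (hl' : 0 < Cmod l) by now apply Cmod_gt_0.
  set (L := Cmod l) in *.
  destruct (hf (Rmin (L / 2) (eps * L * L / 2))) as [d [hd h]].
  (* The first bound keeps [|f w|] above [L / 2]; the second then gives
     [|l - f w| / (|f w| L) < eps]. *)
  { apply Rmin_pos; [lra|]. assert (0 < eps * L) by nra. nra. }
  exists d; split; [exact hd|]. intros w hw hwz.
  assert (H := h w hw hwz).
  assert (H1 := Rlt_le_trans _ _ _ H (Rmin_l _ _)).
  assert (H2 := Rlt_le_trans _ _ _ H (Rmin_r _ _)).
  assert (hfw : L / 2 < Cmod (f w)).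
  { assert (T := Cmod_triangle (f w) (l - f w)).
    replace (f w + (l - f w))%C with l in T by ring.
    rewrite (Cmod_sub_sym l) in T. fold L in T. lra. }
  assert (hfw0 : f w <> 0%C) by (apply Cmod_gt_0; lra).
  replace (/ f w - / l)%C with ((l - f w) / (f w * l))%C by (field; auto).
  rewrite Cmod_div by now apply Cmult_neq_0.
  rewrite Cmod_mult, Cmod_sub_sym. fold L.
  apply Rmult_lt_reg_r with (Cmod (f w) * L); [nra|].
  unfold Rdiv. rewrite Rmult_assoc, Rinv_l by nra.
  assert (0 < eps * L) by nra. nra.
Qed.

Lemma Clim_opp (f : C -> C) (z l : C) :
  Clim f z l -> Clim (fun w => - f w)%C z (- l)%C.
Proof.
  intros hf.
  replace (- l)%C with ((-1)%R * l)%C by ring.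
  apply Clim_ext with (fun w => (-1)%R * f w)%C; [intros; ring|].
  apply Clim_mult; [apply Clim_const|exact hf].
Qed.

Lemma Clim_minus (f g : C -> C) (z l m : C) :
  Clim f z l -> Clim g z m -> Clim (fun w => f w - g w)%C z (l - m)%C.
Proof. intros hf hg. apply Clim_plus; [exact hf|now apply Clim_opp]. Qed.

Lemma Clim_div (f g : C -> C) (z l m : C) :
  m <> 0%C -> Clim f z l -> Clim g z m ->
  Clim (fun w => f w / g w)%C z (l / m)%C.
Proof. intros hm hf hg. apply Clim_mult; [exact hf|now apply Clim_inv]. Qed.

Lemma Clim_neq_0 (f : C -> C) (z l : C) :
  l <> 0%C -> Clim f z l ->
  exists d, 0 < d /\ forall w, w <> z -> Cmod (w - z) < d -> f w <> 0%C.
Proof.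
  intros hl hf. destruct (hf (Cmod l)) as [d [hd h]]; [now apply Cmod_gt_0|].
  exists d; split; [exact hd|]. intros w hw hwz h0.
  assert (H := h w hw hwz). rewrite h0 in H.
  replace (0 - l)%C with (- l)%C in H by ring. rewrite Cmod_opp in H. lra.
Qed.

Lemma Ccont_eps (f : C -> C) (z : C) :
  Ccont f z -> forall eps : R, 0 < eps -> exists d : R, 0 < d /\
    forall w : C, Cmod (w - z) < d -> Cmod (f w - f z) < eps.
Proof.
  intros hf eps heps. destruct (hf eps heps) as [d [hd h]].
  exists d; split; [exact hd|]. intros w hw.
  destruct (Ceq_dec w z) as [->|hne]; [|now apply h].
  replace (f z - f z)%C with (RtoC 0) by ring. now rewrite Cmod_0.
Qed.

Lemma Cderiv_cont (f : C -> C) (z l : C) : Cderiv f z l -> Ccont f z.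
Proof.
  intros hf. unfold Ccont.
  replace (f z) with (l * (z - z) + f z)%C by ring.
  apply Clim_ext with (fun w => (f w - f z) / (w - z) * (w - z) + f z)%C.
  { intros w hw. field. now apply Cminus_eq_contra. }
  apply Clim_plus; [|apply Clim_const].
  apply Clim_mult; [exact hf|].
  apply Clim_minus; [apply Clim_id|apply Clim_const].
Qed.

Lemma Choloc_cont (f : C -> C) (z : C) : Choloc f z -> Ccont f z.
Proof. intros [l h]. now apply Cderiv_cont with l. Qed.

Lemma Cderiv_const (c z : C) : Cderiv (fun _ => c) z 0%C.
Proof.
  apply Clim_ext with (fun _ => RtoC 0); [|apply Clim_const].
  intros w hw. field. now apply Cminus_eq_contra.
Qed.

Lemma Cderiv_id (z : C) : Cderiv (fun w => w) z 1%C.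
Proof.
  apply Clim_ext with (fun _ => RtoC 1); [|apply Clim_const].
  intros w hw. field. now apply Cminus_eq_contra.
Qed.

Lemma Cderiv_plus (f g : C -> C) (z l m : C) :
  Cderiv f z l -> Cderiv g z m -> Cderiv (fun w => f w + g w)%C z (l + m)%C.
Proof.
  intros hf hg. eapply Clim_ext; [|exact (Clim_plus hf hg)].
  intros w hw; simpl. field. now apply Cminus_eq_contra.
Qed.

Lemma Cderiv_mult (f g : C -> C) (z l m : C) :
  Cderiv f z l -> Cderiv g z m ->
  Cderiv (fun w => f w * g w)%C z (l * g z + f z * m)%C.
Proof.
  intros hf hg.
  apply Clim_ext with (fun w => (f w - f z) / (w - z) * g w
                                + f z * ((g w - g z) / (w - z)))%C.
  { intros w hw; simpl. field. now apply Cminus_eq_contra. }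
  apply Clim_plus; apply Clim_mult; auto using Clim_const.
  now apply (Cderiv_cont hg).
Qed.

Lemma Cderiv_opp (f : C -> C) (z l : C) :
  Cderiv f z l -> Cderiv (fun w => - f w)%C z (- l)%C.
Proof.
  intros hf. eapply Clim_ext; [|exact (Clim_opp hf)].
  intros w hw; simpl. field. now apply Cminus_eq_contra.
Qed.

Lemma Cderiv_minus (f g : C -> C) (z l m : C) :
  Cderiv f z l -> Cderiv g z m -> Cderiv (fun w => f w - g w)%C z (l - m)%C.
Proof. intros hf hg. apply Cderiv_plus; [exact hf|now apply Cderiv_opp]. Qed.

Lemma Choloc_inv (f : C -> C) (z : C) :
  f z <> 0%C -> Choloc f z -> Choloc (fun w => / f w)%C z.
Proof.
  intros hz [l hf]. exists (- l / (f z * f z))%C.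
  assert (hc := Cderiv_cont hf).
  destruct (Clim_neq_0 hz hc) as [d [hd hne]].
  apply (@Clim_ext_loc
    (fun w => - ((f w - f z) / (w - z)) / (f w * f z))%C _ z _ d hd).
  { intros w hw hwz; simpl. assert (f w <> 0%C) by auto.
    field. repeat split; auto. now apply Cminus_eq_contra. }
  apply Clim_div; [now apply Cmult_neq_0|now apply Clim_opp|].
  apply Clim_mult; [exact hc|apply Clim_const].
Qed.

Lemma Choloc_mult (f g : C -> C) (z : C) :
  Choloc f z -> Choloc g z -> Choloc (fun w => f w * g w)%C z.
Proof. intros [l hf] [m hg]. eexists. exact (Cderiv_mult hf hg). Qed.

Lemma Choloc_minus (f g : C -> C) (z : C) :
  Choloc f z -> Choloc g z -> Choloc (fun w => f w - g w)%C z.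
Proof. intros [l hf] [m hg]. eexists. exact (Cderiv_minus hf hg). Qed.

Lemma Choloc_const (c z : C) : Choloc (fun _ => c) z.
Proof. eexists. apply Cderiv_const. Qed.

Lemma Choloc_id (z : C) : Choloc (fun w => w) z.
Proof. eexists. apply Cderiv_id. Qed.

(** Since [a <> 0], the affine map is injective and sends punctured neighbourhoods to punctured
    neighbourhoods. *)
Lemma Clim_comp_affine (f : C -> C) (a b z l : C) :
  a <> 0%C -> Clim f (a * z + b)%C l -> Clim (fun w => f (a * w + b)%C) z l.
Proof.
  intros ha hf eps heps.
  destruct (hf eps heps) as [d [hd h]].
  assert (hA : 0 < Cmod a) by now apply Cmod_gt_0.
  exists (d / Cmod a); split; [now apply Rdiv_lt_0_compat|].
  intros w hw hwz.
  assert (E : (a * w + b - (a * z + b))%C = (a * (w - z))%C) by ring.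
  apply h.
  - intros H. apply hw. apply Ceq_minus.
    assert (H' : (a * (w - z))%C = 0%C) by (rewrite <- E, H; ring).
    destruct (Ceq_dec (w - z)%C 0%C) as [e|ne]; [exact e|].
    now destruct (Cmult_neq_0 a (w - z) ha ne).
  - rewrite E, Cmod_mult. apply Rmult_lt_reg_r with (/ Cmod a).
    { now apply Rinv_0_lt_compat. }
    replace (Cmod a * Cmod (w - z) * / Cmod a) with (Cmod (w - z))
      by (field; lra).
    exact hwz.
Qed.

Lemma Cderiv_comp_affine (f : C -> C) (a b z l : C) :
  a <> 0%C -> Cderiv f (a * z + b)%C l ->
  Cderiv (fun w => f (a * w + b)%C) z (a * l)%C.
Proof.
  intros ha hf.
  assert (H := Clim_comp_affine ha hf).
  eapply Clim_ext; [|exact (Clim_mult (@Clim_const a z) H)].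
  intros w hw; simpl.
  replace (a * w + b - (a * z + b))%C with (a * (w - z))%C by ring.
  field. split; [|exact ha]. now apply Cminus_eq_contra.
Qed.

Lemma Rabs_fst_Cmod (z : C) : Rabs (fst z) <= Cmod z.
Proof. eapply Rle_trans; [apply Rmax_l|apply Rmax_Cmod]. Qed.

Lemma Rabs_snd_Cmod (z : C) : Rabs (snd z) <= Cmod z.
Proof. eapply Rle_trans; [apply Rmax_r|apply Rmax_Cmod]. Qed.

Lemma Cmod_le_Rabs (z : C) : Cmod z <= Rabs (fst z) + Rabs (snd z).
Proof.
  destruct z as [x y].
  assert (E : (x, y) = (RtoC x + RtoC y * Ci)%C)
    by (apply injective_projections; simpl; ring).
  rewrite E at 1.
  eapply Rle_trans; [apply Cmod_triangle|].
  rewrite Cmod_mult, Cmod_Ci, !Cmod_R. simpl. lra.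
Qed.

(** * The complex exponential *)

Definition Cexp (z : C) : C :=
  (exp (fst z) * cos (snd z), exp (fst z) * sin (snd z)).

Lemma Cexp_plus (z w : C) : Cexp (z + w)%C = (Cexp z * Cexp w)%C.
Proof.
  unfold Cexp; apply injective_projections; simpl;
    rewrite exp_plus, ?cos_plus, ?sin_plus; ring.
Qed.

Lemma Cexp_0 : Cexp 0%C = 1%C.
Proof.
  unfold Cexp; apply injective_projections; simpl;
    rewrite exp_0, ?cos_0, ?sin_0; ring.
Qed.

Lemma Cmod_Cexp (z : C) : Cmod (Cexp z) = exp (fst z).
Proof.
  unfold Cmod, Cexp; simpl.
  transitivity (sqrt (Rsqr (exp (fst z))));
    [|apply sqrt_Rsqr; left; apply exp_pos].
  f_equal. assert (H := sin2_cos2 (snd z)). unfold Rsqr in *.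
  transitivity (exp (fst z) * exp (fst z)
                * (sin (snd z) * sin (snd z) + cos (snd z) * cos (snd z)));
    [ring|rewrite H; ring].
Qed.

Lemma Cexp_neq_0 (z : C) : Cexp z <> 0%C.
Proof. apply Cmod_gt_0. rewrite Cmod_Cexp. apply exp_pos. Qed.

Lemma Cexp_R (x : R) : Cexp (RtoC x) = RtoC (exp x).
Proof.
  unfold Cexp; apply injective_projections; simpl; rewrite ?cos_0, ?sin_0; ring.
Qed.

Lemma derivable_pt_lim_0_bound (f : R -> R) (l : R) :
  derivable_pt_lim f 0 l -> forall eps, 0 < eps -> exists d, 0 < d /\
  forall x, Rabs x < d -> Rabs (f x - f 0 - l * x) <= eps * Rabs x.
Proof.
  intros hf eps heps. destruct (hf eps heps) as [[d hd] h]. simpl in h.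
  exists d; split; [exact hd|]. intros x hx.
  destruct (Req_dec x 0) as [->|hx0].
  - replace (f 0 - f 0 - l * 0) with 0 by ring. rewrite Rabs_R0. lra.
  - specialize (h x hx0 hx). rewrite Rplus_0_l in h.
    replace (f x - f 0 - l * x) with (((f x - f 0) / x - l) * x)
      by (field; exact hx0).
    rewrite Rabs_mult. apply Rmult_le_compat_r; [apply Rabs_pos|lra].
Qed.

(** First-order expansions of the real [exp], [sin] and [cos] at 0, with errors [u], [v], [t] of
    size [e |w|], are multiplied out in the real and imaginary parts of [Cexp w - 1 - w]. *)
Lemma Cderiv_Cexp_0 : Cderiv Cexp 0%C 1%C.
Proof.
  intros eps heps.
  (* Nine error terms will appear, each at most [e |w|], and [9 / 16 < 1]. The bound by [1 / 8]
     makes products of small terms small again. *)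
  set (e := Rmin (1 / 8) (eps / 16)).
  assert (he : 0 < e) by (apply Rmin_pos; lra).
  assert (he1 : e <= 1 / 8) by apply Rmin_l.
  assert (he2 : e <= eps / 16) by apply Rmin_r.
  destruct (derivable_pt_lim_0_bound derivable_pt_lim_exp_0 he) as [d1 [hd1 h1]].
  destruct (derivable_pt_lim_0_bound derivable_pt_lim_sin_0 he) as [d2 [hd2 h2]].
  destruct (derivable_pt_lim_0_bound (derivable_pt_lim_cos 0) he)
    as [d3 [hd3 h3]].
  exists (Rmin (Rmin d1 d2) (Rmin d3 e)).
  split; [apply Rmin_pos; apply Rmin_pos; assumption|].
  intros w hw hwz.
  replace (w - 0)%C with w in hwz by ring.
  assert (hm : 0 < Cmod w) by now apply Cmod_gt_0.
  assert (Hx := Rabs_fst_Cmod w). assert (Hy := Rabs_snd_Cmod w).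
  assert (B1 := Rmin_l (Rmin d1 d2) (Rmin d3 e)).
  assert (B2 := Rmin_r (Rmin d1 d2) (Rmin d3 e)).
  assert (B3 := Rmin_l d1 d2). assert (B4 := Rmin_r d1 d2).
  assert (B5 := Rmin_l d3 e). assert (B6 := Rmin_r d3 e).
  rewrite Cexp_0.
  replace ((Cexp w - 1) / (w - 0) - 1)%C with ((Cexp w - 1 - w) / w)%C
    by (replace (w - 0)%C with w by ring; field; exact hw).
  rewrite Cmod_div by exact hw.
  apply Rmult_lt_reg_r with (Cmod w); [exact hm|].
  unfold Rdiv at 1. rewrite Rmult_assoc, Rinv_l, Rmult_1_r by lra.
  eapply Rle_lt_trans; [apply Cmod_le_Rabs|].
  destruct w as [x y]. simpl in *.
  specialize (h1 x). specialize (h2 y). specialize (h3 y).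
  rewrite exp_0 in h1. rewrite sin_0 in h2, h3. rewrite cos_0 in h3.
  assert (H1 : Rabs (exp x - 1 - 1 * x) <= e * Rabs x) by (apply h1; lra).
  assert (H2 : Rabs (sin y - 0 - 1 * y) <= e * Rabs y) by (apply h2; lra).
  assert (H3 : Rabs (cos y - 1 - - 0 * y) <= e * Rabs y) by (apply h3; lra).
  clear h1 h2 h3.
  set (u := exp x - 1 - 1 * x) in *. set (v := sin y - 0 - 1 * y) in *.
  set (t := cos y - 1 - - 0 * y) in *.
  replace (exp x * cos y + - (1) + - x)
    with (u + t + u * t + x * t) by (unfold u, t; ring).
  replace (exp x * sin y + - 0 + - y)
    with (v + u * v + u * y + x * v + x * y) by (unfold u, v; ring).
  set (M := Cmod (x, y)) in *.
  assert (hu : Rabs u <= e * M) by nra.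
  assert (hv : Rabs v <= e * M) by nra.
  assert (ht : Rabs t <= e * M) by nra.
  assert (hM : M < e) by lra.
  (* [P] bounds a product of two terms by the product of their bounds; it is applied to the six
     mixed terms. *)
  assert (P := fun a b A B (ha : Rabs a <= A) (hb : Rabs b <= B) =>
    eq_ind_r (fun z => z <= A * B)
      (Rmult_le_compat _ _ _ _ (Rabs_pos a) (Rabs_pos b) ha hb)
      (Rabs_mult a b)).
  assert (p1 := P u t _ _ hu ht). assert (p2 := P x t _ _ Hx ht).
  assert (p3 := P u v _ _ hu hv). assert (p4 := P u y _ _ hu Hy).
  assert (p5 := P x v _ _ Hx hv). assert (p6 := P x y _ _ Hx Hy).
  assert (hM1 : M <= 1) by lra.
  assert (hE : 0 < e * M) by (apply Rmult_lt_0_compat; lra).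
  assert (hE1 : e * M <= 1) by nra.
  assert (q1 : e * M * (e * M) <= e * M).
  { rewrite <- (Rmult_1_r (e * M)) at 3. apply Rmult_le_compat_l; lra. }
  assert (q2 : M * (e * M) <= e * M).
  { rewrite <- (Rmult_1_l (e * M)) at 2. apply Rmult_le_compat_r; lra. }
  assert (q3 : e * M * M <= e * M) by lra.
  assert (q4 : M * M <= e * M) by (apply Rmult_le_compat_r; lra).
  assert (q5 : e * M <= eps / 16 * M) by (apply Rmult_le_compat_r; lra).
  assert (q6 : 0 < eps * M) by (apply Rmult_lt_0_compat; lra).
  assert (T1 := Rabs_triang (u + t + u * t) (x * t)).
  assert (T2 := Rabs_triang (u + t) (u * t)).
  assert (T3 := Rabs_triang u t).
  assert (T4 := Rabs_triang (v + u * v + u * y + x * v) (x * y)).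
  assert (T5 := Rabs_triang (v + u * v + u * y) (x * v)).
  assert (T6 := Rabs_triang (v + u * v) (u * y)).
  assert (T7 := Rabs_triang v (u * v)).
  lra.
Qed.

(** The addition formula transports the derivative from 0 to [z]. *)
Lemma Cderiv_Cexp (z : C) : Cderiv Cexp z (Cexp z).
Proof.
  assert (H : Cderiv (fun w => Cexp (1 * w + - z)%C) z (1 * 1)%C).
  { apply (@Cderiv_comp_affine Cexp 1%C (- z)%C z 1%C C1_nz).
    replace (1 * z + - z)%C with (RtoC 0) by ring. apply Cderiv_Cexp_0. }
  assert (H2 := Cderiv_mult (Cderiv_const (Cexp z) z) H). simpl in H2.
  replace (Cexp z) with (0 * Cexp (1 * z + - z) + Cexp z * (1 * 1))%C at 1
    by ring.
  eapply Clim_ext; [|exact H2].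
  intros w hw; simpl. rewrite <- !Cexp_plus.
  now replace (z + (1 * w + - z))%C with w by ring;
    replace (z + (1 * z + - z))%C with z by ring.
Qed.

(** * Integration along the boundary of a rectangle *)

Notation CV := C_R_CompleteNormedModule.

(** Counterclockwise orientation. Opposite sides are paired under one integral: the paired integrand
    is constant for an affine function, and a real function times a constant for [1 / (z - a)] on a
    centred square, so both are computed explicitly. *)
Definition rectint (f : C -> C) (x1 x2 y1 y2 : R) : C :=
  (RInt (V := CV) (fun x => f (x, y1) - f (x, y2))%C x1 x2
   + Ci * RInt (V := CV) (fun y => f (x2, y) - f (x1, y))%C y1 y2)%C.

Definition on_rect (x1 x2 y1 y2 : R) (z : C) : Prop :=
  x1 <= fst z <= x2 /\ y1 <= snd z <= y2.

Lemma norm_C_R (z : C) : norm (V := C_R_NormedModule) z = Cmod z.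
Proof. symmetry. apply Cmod_norm. Qed.

Lemma continuous_of_eps (f : R -> C) (x : R) :
  (forall eps, 0 < eps -> exists d, 0 < d /\
     forall t, Rabs (t - x) < d -> Cmod (f t - f x) < eps) ->
  continuous (U := C_R_NormedModule) f x.
Proof.
  intros h. apply filterlim_locally. intros [eps heps].
  destruct (h eps heps) as [d [hd H]].
  exists (mkposreal d hd). intros t ht.
  apply C_NormedModule_mixin_compat1. now apply H.
Qed.

Lemma continuous_hseg (f : C -> C) (x y : R) :
  Ccont f (x, y) -> continuous (U := C_R_NormedModule) (fun t => f (t, y)) x.
Proof.
  intros h. apply continuous_of_eps. intros eps heps.
  destruct (Ccont_eps h heps) as [d [hd H]].
  exists d; split; [exact hd|]. intros t ht. apply H.
  change (Cmod ((t, y) - (x, y))%C < d).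
  assert (E : ((t, y) - (x, y))%C = RtoC (t - x))
    by (apply injective_projections; simpl; ring).
  now rewrite E, Cmod_R.
Qed.

Lemma continuous_vseg (f : C -> C) (x y : R) :
  Ccont f (x, y) -> continuous (U := C_R_NormedModule) (fun t => f (x, t)) y.
Proof.
  intros h. apply continuous_of_eps. intros eps heps.
  destruct (Ccont_eps h heps) as [d [hd H]].
  exists d; split; [exact hd|]. intros t ht. apply H.
  change (Cmod ((x, t) - (x, y))%C < d).
  assert (E : ((x, t) - (x, y))%C = (RtoC (t - y) * Ci)%C)
    by (apply injective_projections; simpl; ring).
  now rewrite E, Cmod_mult, Cmod_R, Cmod_Ci, Rmult_1_r.
Qed.

Lemma ex_RInt_hseg (f : C -> C) (a b y : R) :
  a <= b -> (forall t, a <= t <= b -> Ccont f (t, y)) ->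
  ex_RInt (V := CV) (fun x => f (x, y)) a b.
Proof.
  intros hab h. apply (@ex_RInt_continuous CV). intros t ht.
  rewrite Rmin_left, Rmax_right in ht by exact hab.
  now apply continuous_hseg, h.
Qed.

Lemma ex_RInt_vseg (f : C -> C) (x a b : R) :
  a <= b -> (forall t, a <= t <= b -> Ccont f (x, t)) ->
  ex_RInt (V := CV) (fun y => f (x, y)) a b.
Proof.
  intros hab h. apply (@ex_RInt_continuous CV). intros t ht.
  rewrite Rmin_left, Rmax_right in ht by exact hab.
  now apply continuous_vseg, h.
Qed.

(* Continuity on the four sides only: the integrands below are singular inside
   the rectangle. *)
Definition cont_sides (f : C -> C) (x1 x2 y1 y2 : R) : Prop :=
  (forall x, x1 <= x <= x2 -> Ccont f (x, y1) /\ Ccont f (x, y2))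
  /\ (forall y, y1 <= y <= y2 -> Ccont f (x1, y) /\ Ccont f (x2, y)).

Lemma rectint_sides (f : C -> C) (x1 x2 y1 y2 : R) :
  x1 <= x2 -> y1 <= y2 -> cont_sides f x1 x2 y1 y2 ->
  rectint f x1 x2 y1 y2 =
  (RInt (V := CV) (fun x => f (x, y1)) x1 x2
   - RInt (V := CV) (fun x => f (x, y2)) x1 x2
   + Ci * (RInt (V := CV) (fun y => f (x2, y)) y1 y2
           - RInt (V := CV) (fun y => f (x1, y)) y1 y2))%C.
Proof.
  intros hx hy [h1 h2]. unfold rectint.
  f_equal; [|f_equal].
  - apply (@RInt_minus CV (fun x => f (x, y1)) (fun x => f (x, y2)));
      apply ex_RInt_hseg; auto; intros t ht; now destruct (h1 t ht).
  - apply (@RInt_minus CV (fun y => f (x2, y)) (fun y => f (x1, y)));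
      apply ex_RInt_vseg; auto; intros t ht; now destruct (h2 t ht).
Qed.

Lemma RInt_ChaslesC (g : R -> C) (a b c : R) :
  ex_RInt (V := CV) g a b -> ex_RInt (V := CV) g b c ->
  RInt (V := CV) g a c = (RInt (V := CV) g a b + RInt (V := CV) g b c)%C.
Proof. intros h1 h2. symmetry. exact (@RInt_Chasles CV g a b c h1 h2). Qed.

Lemma RInt_plusC (g k : R -> C) (a b : R) :
  ex_RInt (V := CV) g a b -> ex_RInt (V := CV) k a b ->
  RInt (V := CV) (fun x => g x + k x)%C a b
  = (RInt (V := CV) g a b + RInt (V := CV) k a b)%C.
Proof. exact (@RInt_plus CV g k a b). Qed.

(** The common side is run through in both directions. Continuity on the outer sides is returned
    along with the identity, so that rectangles can be glued one after another. *)
Lemma rectint_hsplit (f : C -> C) (x1 x2 x3 y1 y2 : R) :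
  x1 <= x2 <= x3 -> y1 <= y2 ->
  cont_sides f x1 x2 y1 y2 -> cont_sides f x2 x3 y1 y2 ->
  cont_sides f x1 x3 y1 y2 /\
  rectint f x1 x3 y1 y2 = (rectint f x1 x2 y1 y2 + rectint f x2 x3 y1 y2)%C.
Proof.
  intros [hx hx'] hy [h1 h2] [h3 h4].
  assert (h : cont_sides f x1 x3 y1 y2).
  { split.
    - intros x hxx. destruct (Rle_dec x x2); [apply h1|apply h3]; lra.
    - intros y hyy. destruct (h2 y hyy), (h4 y hyy). now split. }
  split; [exact h|].
  rewrite !rectint_sides by (try lra; try exact h; now split).
  assert (A : forall y, (forall x, x1 <= x <= x2 -> Ccont f (x, y)) ->
            (forall x, x2 <= x <= x3 -> Ccont f (x, y)) ->
            RInt (V := CV) (fun x => f (x, y)) x1 x3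
            = (RInt (V := CV) (fun x => f (x, y)) x1 x2
               + RInt (V := CV) (fun x => f (x, y)) x2 x3)%C).
  { intros y g1 g2. apply RInt_ChaslesC; apply ex_RInt_hseg; auto. }
  rewrite (A y1), (A y2).
  - ring.
  - intros x hh; now destruct (h1 x hh).
  - intros x hh; now destruct (h3 x hh).
  - intros x hh; now destruct (h1 x hh).
  - intros x hh; now destruct (h3 x hh).
Qed.

Lemma rectint_vsplit (f : C -> C) (x1 x2 y1 y2 y3 : R) :
  x1 <= x2 -> y1 <= y2 <= y3 ->
  cont_sides f x1 x2 y1 y2 -> cont_sides f x1 x2 y2 y3 ->
  cont_sides f x1 x2 y1 y3 /\
  rectint f x1 x2 y1 y3 = (rectint f x1 x2 y1 y2 + rectint f x1 x2 y2 y3)%C.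
Proof.
  intros hx [hy hy'] [h1 h2] [h3 h4].
  assert (h : cont_sides f x1 x2 y1 y3).
  { split.
    - intros x hxx. destruct (h1 x hxx), (h3 x hxx). now split.
    - intros y hyy. destruct (Rle_dec y y2); [apply h2|apply h4]; lra. }
  split; [exact h|].
  rewrite !rectint_sides by (try lra; try exact h; now split).
  assert (A : forall x, (forall y, y1 <= y <= y2 -> Ccont f (x, y)) ->
            (forall y, y2 <= y <= y3 -> Ccont f (x, y)) ->
            RInt (V := CV) (fun y => f (x, y)) y1 y3
            = (RInt (V := CV) (fun y => f (x, y)) y1 y2
               + RInt (V := CV) (fun y => f (x, y)) y2 y3)%C).
  { intros x g1 g2. apply RInt_ChaslesC; apply ex_RInt_vseg; auto. }
  rewrite (A x1), (A x2).
  - ring.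
  - intros x hh; now destruct (h2 x hh).
  - intros x hh; now destruct (h4 x hh).
  - intros x hh; now destruct (h2 x hh).
  - intros x hh; now destruct (h4 x hh).
Qed.

Lemma Cmod_RInt_le (g : R -> C) (a b M : R) :
  a <= b -> ex_RInt (V := CV) g a b ->
  (forall x, a <= x <= b -> Cmod (g x) <= M) ->
  Cmod (RInt (V := CV) g a b) <= (b - a) * M.
Proof.
  intros hab [l hl] hM. rewrite (is_RInt_unique (V := CV) _ _ _ _ hl).
  rewrite <- norm_C_R.
  apply (@norm_RInt_le_const C_R_NormedModule g a b l M hab); [|exact hl].
  intros x hx. rewrite norm_C_R. now apply hM.
Qed.

Lemma rectint_le (f : C -> C) (x1 x2 y1 y2 M : R) :
  x1 <= x2 -> y1 <= y2 -> cont_sides f x1 x2 y1 y2 ->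
  (forall x, x1 <= x <= x2 -> Cmod (f (x, y1)) <= M /\ Cmod (f (x, y2)) <= M) ->
  (forall y, y1 <= y <= y2 -> Cmod (f (x1, y)) <= M /\ Cmod (f (x2, y)) <= M) ->
  Cmod (rectint f x1 x2 y1 y2) <= 2 * (x2 - x1 + (y2 - y1)) * M.
Proof.
  intros hx hy hc hM1 hM2. rewrite (rectint_sides hx hy hc).
  destruct hc as [h1 h2].
  eapply Rle_trans; [apply Cmod_triangle|].
  rewrite Cmod_mult, Cmod_Ci, Rmult_1_l.
  assert (T : forall a b : C, Cmod (a - b) <= Cmod a + Cmod b).
  { intros a b. unfold Cminus. rewrite <- (Cmod_opp b). apply Cmod_triangle. }
  eapply Rle_trans; [apply Rplus_le_compat; apply T|].
  assert (A1 : Cmod (RInt (V := CV) (fun x => f (x, y1)) x1 x2)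
               <= (x2 - x1) * M).
  { apply Cmod_RInt_le; [exact hx|apply ex_RInt_hseg; auto|];
      intros x hxx; [now destruct (h1 x hxx)|now destruct (hM1 x hxx)]. }
  assert (A2 : Cmod (RInt (V := CV) (fun x => f (x, y2)) x1 x2)
               <= (x2 - x1) * M).
  { apply Cmod_RInt_le; [exact hx|apply ex_RInt_hseg; auto|];
      intros x hxx; [now destruct (h1 x hxx)|now destruct (hM1 x hxx)]. }
  assert (A3 : Cmod (RInt (V := CV) (fun y => f (x1, y)) y1 y2)
               <= (y2 - y1) * M).
  { apply Cmod_RInt_le; [exact hy|apply ex_RInt_vseg; auto|];
      intros x hxx; [now destruct (h2 x hxx)|now destruct (hM2 x hxx)]. }
  assert (A4 : Cmod (RInt (V := CV) (fun y => f (x2, y)) y1 y2)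
               <= (y2 - y1) * M).
  { apply Cmod_RInt_le; [exact hy|apply ex_RInt_vseg; auto|];
      intros x hxx; [now destruct (h2 x hxx)|now destruct (hM2 x hxx)]. }
  lra.
Qed.

(** * Linearity of the rectangle integral, and affine integrands *)

Lemma cont_sides_on_rect (f : C -> C) (x1 x2 y1 y2 : R) :
  x1 <= x2 -> y1 <= y2 ->
  (forall z, on_rect x1 x2 y1 y2 z -> Ccont f z) -> cont_sides f x1 x2 y1 y2.
Proof.
  intros hx hy h. split; intros t ht; split; apply h; split; simpl; lra.
Qed.

Lemma cont_sides_plus (f g : C -> C) (x1 x2 y1 y2 : R) :
  cont_sides f x1 x2 y1 y2 -> cont_sides g x1 x2 y1 y2 ->
  cont_sides (fun z => f z + g z)%C x1 x2 y1 y2.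
Proof.
  intros [h1 h2] [h3 h4].
  split; intros t ht; split; apply Clim_plus;
    try (now apply (h1 t ht)); try (now apply (h2 t ht));
    try (now apply (h3 t ht)); try (now apply (h4 t ht)).
Qed.

Lemma rectint_plus (f g : C -> C) (x1 x2 y1 y2 : R) :
  x1 <= x2 -> y1 <= y2 ->
  cont_sides f x1 x2 y1 y2 -> cont_sides g x1 x2 y1 y2 ->
  rectint (fun z => f z + g z)%C x1 x2 y1 y2
  = (rectint f x1 x2 y1 y2 + rectint g x1 x2 y1 y2)%C.
Proof.
  intros hx hy hf hg.
  rewrite (rectint_sides hx hy (cont_sides_plus hf hg)).
  rewrite (rectint_sides hx hy hf), (rectint_sides hx hy hg).
  destruct hf as [h1 h2], hg as [h3 h4].
  rewrite (@RInt_plusC (fun x => f (x, y1)) (fun x => g (x, y1)) x1 x2)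
    by (apply (ex_RInt_hseg hx); intros t ht;
        destruct (h1 t ht), (h3 t ht); assumption).
  rewrite (@RInt_plusC (fun x => f (x, y2)) (fun x => g (x, y2)) x1 x2)
    by (apply (ex_RInt_hseg hx); intros t ht;
        destruct (h1 t ht), (h3 t ht); assumption).
  rewrite (@RInt_plusC (fun y => f (x2, y)) (fun y => g (x2, y)) y1 y2)
    by (apply (ex_RInt_vseg hy); intros t ht;
        destruct (h2 t ht), (h4 t ht); assumption).
  rewrite (@RInt_plusC (fun y => f (x1, y)) (fun y => g (x1, y)) y1 y2)
    by (apply (ex_RInt_vseg hy); intros t ht;
        destruct (h2 t ht), (h4 t ht); assumption).
  ring.
Qed.

Lemma scal_C_R (x : R) (z : C) : scal (V := CV) x z = (RtoC x * z)%C.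
Proof. apply scal_R_Cmult. Qed.

(** The two pairs of sides contribute opposite multiples of [Ci b (x2 - x1) (y2 - y1)]. *)
Lemma rectint_affine (a b : C) (x1 x2 y1 y2 : R) :
  rectint (fun z => a + b * z)%C x1 x2 y1 y2 = 0%C.
Proof.
  assert (A : forall (g : R -> C) (k : C) u v, (forall t, g t = k) ->
            RInt (V := CV) g u v = (RtoC (v - u) * k)%C).
  { intros g k u v hg. rewrite (@RInt_ext CV g (fun _ => k)) by auto.
    rewrite (@RInt_const CV). apply scal_C_R. }
  assert (E : forall x y : R, (x, y) = (RtoC x + Ci * RtoC y)%C)
    by (intros; apply injective_projections; simpl; ring).
  unfold rectint.
  rewrite (A _ (b * (Ci * RtoC (y1 - y2)))%C)
    by (intros t; rewrite !E, RtoC_minus; ring).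
  rewrite (A _ (b * RtoC (x2 - x1))%C)
    by (intros t; rewrite !E, RtoC_minus; ring).
  rewrite !RtoC_minus. ring.
Qed.

(** [RInt] is linear over the reals; a complex factor is handled through real and imaginary
    parts. *)
Lemma RInt_scalC (g : R -> C) (c : C) (a b : R) :
  ex_RInt (V := CV) g a b ->
  RInt (V := CV) (fun x => c * g x)%C a b = (c * RInt (V := CV) g a b)%C.
Proof.
  intros [l hl]. rewrite (is_RInt_unique (V := CV) _ _ _ _ hl).
  apply (is_RInt_unique (V := CV)).
  destruct c as [u v].
  assert (h1 := @is_RInt_fct_extend_fst R_NormedModule R_NormedModule
                _ _ _ _ hl).
  assert (h2 := @is_RInt_fct_extend_snd R_NormedModule R_NormedModule
                _ _ _ _ hl).
  apply (@is_RInt_fct_extend_pair R_NormedModule R_NormedModule); simpl.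
  - exact (@is_RInt_minus R_NormedModule _ _ _ _ _ _
      (@is_RInt_scal R_NormedModule _ _ _ u _ h1)
      (@is_RInt_scal R_NormedModule _ _ _ v _ h2)).
  - exact (@is_RInt_plus R_NormedModule _ _ _ _ _ _
      (@is_RInt_scal R_NormedModule _ _ _ u _ h2)
      (@is_RInt_scal R_NormedModule _ _ _ v _ h1)).
Qed.

Lemma rectint_scal (f : C -> C) (c : C) (x1 x2 y1 y2 : R) :
  x1 <= x2 -> y1 <= y2 -> cont_sides f x1 x2 y1 y2 ->
  rectint (fun z => c * f z)%C x1 x2 y1 y2 = (c * rectint f x1 x2 y1 y2)%C.
Proof.
  intros hx hy hf.
  assert (hc : cont_sides (fun z => c * f z)%C x1 x2 y1 y2).
  { destruct hf as [h1 h2].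
    split; intros t ht; split; (apply Clim_mult; [apply Clim_const|]);
      first [now apply h1|now apply h2]. }
  rewrite (rectint_sides hx hy hc), (rectint_sides hx hy hf).
  destruct hf as [h1 h2].
  rewrite (@RInt_scalC (fun x => f (x, y1)))
    by (apply (ex_RInt_hseg hx); intros t ht; now destruct (h1 t ht)).
  rewrite (@RInt_scalC (fun x => f (x, y2)))
    by (apply (ex_RInt_hseg hx); intros t ht; now destruct (h1 t ht)).
  rewrite (@RInt_scalC (fun y => f (x1, y)))
    by (apply (ex_RInt_vseg hy); intros t ht; now destruct (h2 t ht)).
  rewrite (@RInt_scalC (fun y => f (x2, y)))
    by (apply (ex_RInt_vseg hy); intros t ht; now destruct (h2 t ht)).
  ring.
Qed.

(** * The Cauchy-Goursat theorem for rectangles *)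

Lemma nested_intervals (u v : nat -> R) :
  (forall n, u n <= v n) -> (forall n, u n <= u (S n)) ->
  (forall n, v (S n) <= v n) ->
  exists X, forall n, u n <= X <= v n.
Proof.
  intros huv hu hv.
  assert (mu : forall n k, u n <= u (n + k)%nat).
  { intros n k. induction k as [|k IH]; [rewrite Nat.add_0_r; lra|].
    rewrite Nat.add_succ_r. eapply Rle_trans; [exact IH|apply hu]. }
  assert (mv : forall n k, v (n + k)%nat <= v n).
  { intros n k. induction k as [|k IH]; [rewrite Nat.add_0_r; lra|].
    rewrite Nat.add_succ_r. eapply Rle_trans; [apply hv|exact IH]. }
  assert (H : forall m n, u m <= v n).
  { intros m n. eapply Rle_trans; [apply (mu m n)|].
    eapply Rle_trans; [apply huv|]. rewrite Nat.add_comm. apply mv. }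
  destruct (completeness (fun x => exists n, x = u n)) as [X [h1 h2]].
  - exists (v O). intros x [n ->]. apply H.
  - exists (u O). now exists O.
  - exists X. intros n. split; [apply h1; now exists n|].
    apply h2. intros x [m ->]. apply H.
Qed.

(** A rectangle where [P] fails has a quarter where it fails. Iterating gives nested rectangles that
    shrink to a point [(X, Y)], against the local hypothesis there. The index [n] records the scale
    [w / 2 ^ n] by [h / 2 ^ n], and [(x, y)] is the lower left corner. *)
Lemma quad_bisection (P : nat -> R -> R -> Prop) (w h x0 y0 : R) :
  0 <= w -> 0 <= h ->
  (forall n x y,
     P (S n) x y -> P (S n) (x + w / 2 ^ S n) y ->
     P (S n) x (y + h / 2 ^ S n) ->
     P (S n) (x + w / 2 ^ S n) (y + h / 2 ^ S n) -> P n x y) ->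
  (forall X Y, x0 <= X <= x0 + w -> y0 <= Y <= y0 + h ->
     exists N, forall n x y, (N <= n)%nat ->
       x <= X <= x + w / 2 ^ n -> y <= Y <= y + h / 2 ^ n -> P n x y) ->
  P O x0 y0.
Proof.
  intros hw hh hstep hloc. apply NNPP. intros h0.
  assert (step : forall n (p : R * R), ~ P n (fst p) (snd p) ->
    exists q : R * R, ~ P (S n) (fst q) (snd q) /\
      (fst q = fst p \/ fst q = fst p + w / 2 ^ S n) /\
      (snd q = snd p \/ snd q = snd p + h / 2 ^ S n)).
  { intros n [x y] hp. simpl fst in *; simpl snd in *.
    apply NNPP. intros hn. apply hp. apply hstep; apply NNPP; intros hc;
      apply hn; eexists (_, _); (split; [exact hc|]); simpl; tauto. }
  set (T := fun n => {p : R * R | ~ P n (fst p) (snd p)}).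
  (* The failing quarter is picked by choice; the corner travels with its proof of failure, hence
     the dependent type [T n]. *)
  set (next := fun n (t : T n) =>
    let q := constructive_indefinite_description _
               (step n (proj1_sig t) (proj2_sig t)) in
    exist (fun p => ~ P (S n) (fst p) (snd p)) (proj1_sig q)
      (proj1 (proj2_sig q)) : T (S n)).
  set (s := fix s n : T n :=
    match n with
    | O => exist (fun p => ~ P O (fst p) (snd p)) (x0, y0) h0
    | S m => next m (s m)
    end).
  set (x := fun n => fst (proj1_sig (s n))).
  set (y := fun n => snd (proj1_sig (s n))).
  assert (hs : forall n,
      (x (S n) = x n \/ x (S n) = x n + w / 2 ^ S n) /\
      (y (S n) = y n \/ y (S n) = y n + h / 2 ^ S n)).
  { intros n.
    exact (proj2 (proj2_sig (constructive_indefinite_description _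
             (step n (proj1_sig (s n)) (proj2_sig (s n)))))). }
  assert (half : forall a n, a / 2 ^ n = a / 2 ^ S n + a / 2 ^ S n).
  { intros a n. simpl. field. apply pow_nonzero. lra. }
  assert (pos : forall a n, 0 <= a -> 0 <= a / 2 ^ n).
  { intros a n ha. apply Rmult_le_pos; [exact ha|].
    left. apply Rinv_0_lt_compat, pow_lt. lra. }
  destruct (@nested_intervals x (fun n => x n + w / 2 ^ n)) as [X hX].
  { intros n. specialize (pos w n hw). lra. }
  { intros n. assert (p := pos w (S n) hw). destruct (hs n) as [[e|e] _]; lra. }
  { intros n. assert (p := pos w (S n) hw). assert (q := half w n).
    destruct (hs n) as [[e|e] _]; lra. }
  destruct (@nested_intervals y (fun n => y n + h / 2 ^ n)) as [Y hY].
  { intros n. specialize (pos h n hh). lra. }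
  { intros n. assert (p := pos h (S n) hh). destruct (hs n) as [_ [e|e]]; lra. }
  { intros n. assert (p := pos h (S n) hh). assert (q := half h n).
    destruct (hs n) as [_ [e|e]]; lra. }
  destruct (hloc X Y) as [N hN].
  { assert (H := hX O). unfold x in H. simpl in H. lra. }
  { assert (H := hY O). unfold y in H. simpl in H. lra. }
  exact (proj2_sig (s N) (hN N (x N) (y N) (Nat.le_refl N) (hX N) (hY N))).
Qed.

Lemma Cderiv_bound (f : C -> C) (p l : C) (e : R) :
  Cderiv f p l -> 0 < e -> exists d, 0 < d /\
  forall z, Cmod (z - p) < d ->
    Cmod (f z - f p - l * (z - p)) <= e * Cmod (z - p).
Proof.
  intros hf he. destruct (hf e he) as [d [hd H]].
  exists d; split; [exact hd|]. intros z hz.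
  destruct (Ceq_dec z p) as [->|hne].
  - replace (f p - f p - l * (p - p))%C with (RtoC 0) by ring.
    rewrite Cmod_0. assert (h := Cmod_ge_0 (p - p)). nra.
  - replace (f z - f p - l * (z - p))%C
      with (((f z - f p) / (z - p) - l) * (z - p))%C
      by (field; now apply Cminus_eq_contra).
    rewrite Cmod_mult. apply Rmult_le_compat_r; [apply Cmod_ge_0|].
    left. now apply H.
Qed.

(** The tangent affine function at [p] integrates to 0, so it can be subtracted. On a rectangle of
    half-perimeter [D] the remainder is at most [e D], and the perimeter is [2 D]. *)
Lemma goursat_local (f : C -> C) (p : C) (e : R) :
  Choloc f p -> 0 < e -> exists d, 0 < d /\
  forall x1 x2 y1 y2, on_rect x1 x2 y1 y2 p ->
    x2 - x1 + (y2 - y1) < d -> cont_sides f x1 x2 y1 y2 ->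
    Cmod (rectint f x1 x2 y1 y2) <= 2 * e * (x2 - x1 + (y2 - y1)) ^ 2.
Proof.
  intros [l hl] he. destruct (Cderiv_bound hl he) as [d [hd H]].
  exists d; split; [exact hd|]. intros x1 x2 y1 y2 [hx hy] hs hc.
  set (D := x2 - x1 + (y2 - y1)) in *.
  set (A := fun z => ((l * p - f p) + (- l) * z)%C).
  assert (cA : cont_sides A x1 x2 y1 y2).
  { apply cont_sides_on_rect; [lra|lra|]. intros z _.
    apply Choloc_cont. eexists. apply Cderiv_plus; [apply Cderiv_const|].
    apply Cderiv_mult; [apply Cderiv_const|apply Cderiv_id]. }
  assert (E : rectint f x1 x2 y1 y2
              = rectint (fun z => f z + A z)%C x1 x2 y1 y2).
  { rewrite rectint_plus by (try lra; assumption).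
    unfold A at 1. rewrite rectint_affine. ring. }
  assert (B : forall z, on_rect x1 x2 y1 y2 z -> Cmod (f z + A z) <= e * D).
  { intros z [hzx hzy].
    assert (hz : Cmod (z - p) <= D).
    { eapply Rle_trans; [apply Cmod_le_Rabs|]. unfold D. simpl.
      apply Rplus_le_compat; apply Rabs_le; lra. }
    unfold A. replace (f z + _)%C with (f z - f p - l * (z - p))%C by ring.
    eapply Rle_trans; [apply H; lra|]. apply Rmult_le_compat_l; lra. }
  rewrite E. replace (2 * e * D ^ 2) with (2 * D * (e * D)) by ring.
  apply rectint_le; try lra.
  - now apply cont_sides_plus.
  - intros x hxx. split; apply B; split; simpl; lra.
  - intros y hyy. split; apply B; split; simpl; lra.
Qed.

Lemma rectint_quarters (f : C -> C) (x1 x2 x3 y1 y2 y3 : R) :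
  x1 <= x2 <= x3 -> y1 <= y2 <= y3 ->
  (forall z, on_rect x1 x3 y1 y3 z -> Ccont f z) ->
  rectint f x1 x3 y1 y3 =
  (rectint f x1 x2 y1 y2 + rectint f x2 x3 y1 y2
   + (rectint f x1 x2 y2 y3 + rectint f x2 x3 y2 y3))%C.
Proof.
  intros hx hy hc.
  assert (c : forall a b u v, x1 <= a <= b -> b <= x3 -> y1 <= u <= v ->
              v <= y3 -> cont_sides f a b u v).
  { intros a b u v h1 h2 h3 h4. apply cont_sides_on_rect; try lra.
    intros z [hz1 hz2]. apply hc. split; lra. }
  destruct (@rectint_vsplit f x1 x3 y1 y2 y3) as [_ ->];
    try lra; try (apply c; lra).
  destruct (@rectint_hsplit f x1 x2 x3 y1 y2) as [_ ->];
    try lra; try (apply c; lra).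
  destruct (@rectint_hsplit f x1 x2 x3 y2 y3) as [_ ->];
    try lra; try (apply c; lra).
  reflexivity.
Qed.

Theorem goursat_rect (f : C -> C) (x1 x2 y1 y2 : R) :
  x1 <= x2 -> y1 <= y2 ->
  (forall z, on_rect x1 x2 y1 y2 z -> Choloc f z) ->
  rectint f x1 x2 y1 y2 = 0%C.
Proof.
  intros hx hy hf. apply Cmod_eq_0.
  apply Rle_antisym; [|apply Cmod_ge_0]. apply le_epsilon. intros eps heps.
  rewrite Rplus_0_l.
  set (w := x2 - x1). set (h := y2 - y1).
  assert (hw : 0 <= w) by (unfold w; lra).
  assert (hh : 0 <= h) by (unfold h; lra).
  assert (pp : forall n, 0 < 2 ^ n) by (intros n; apply pow_lt; lra).
  assert (pos : forall a n, 0 <= a -> 0 <= a / 2 ^ n).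
  { intros a n ha. apply Rmult_le_pos; [exact ha|].
    left. now apply Rinv_0_lt_compat. }
  assert (half : forall a n, a / 2 ^ n = a / 2 ^ S n + a / 2 ^ S n).
  { intros a n. simpl. field. apply pow_nonzero. lra. }
  (* The bound is [eps / 4^n], written [eps / (2 ^ n) ^ 2]: four quarters at scale [n + 1] add up to
     one rectangle at scale [n]. *)
  set (P := fun (n : nat) x y =>
    x1 <= x -> x + w / 2 ^ n <= x2 -> y1 <= y -> y + h / 2 ^ n <= y2 ->
    Cmod (rectint f x (x + w / 2 ^ n) y (y + h / 2 ^ n)) <= eps / (2 ^ n) ^ 2).
  assert (H : P O x1 y1).
  { apply (@quad_bisection P w h x1 y1 hw hh).
    - intros n x y p1 p2 p3 p4 a1 a2 b1 b2.
      assert (hw' := pos w (S n) hw). assert (hh' := pos h (S n) hh).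
      assert (ew := half w n). assert (eh := half h n).
      rewrite (@rectint_quarters f x (x + w / 2 ^ S n) _ y (y + h / 2 ^ S n) _);
        try lra.
      2:{ intros z [hz1 hz2]. apply Choloc_cont, hf. split; lra. }
      rewrite ew, eh, <- !Rplus_assoc.
      specialize (p1 ltac:(lra) ltac:(lra) ltac:(lra) ltac:(lra)).
      specialize (p2 ltac:(lra) ltac:(lra) ltac:(lra) ltac:(lra)).
      specialize (p3 ltac:(lra) ltac:(lra) ltac:(lra) ltac:(lra)).
      specialize (p4 ltac:(lra) ltac:(lra) ltac:(lra) ltac:(lra)).
      eapply Rle_trans; [apply Cmod_triangle|].
      eapply Rle_trans; [apply Rplus_le_compat; apply Cmod_triangle|].
      replace (eps / (2 ^ n) ^ 2) with (4 * (eps / (2 ^ S n) ^ 2)); [lra|].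
      simpl. field. apply pow_nonzero. lra.
    - intros X Y hX hY.
      set (D := w + h).
      (* Makes [2 e D^2 <= eps]; the [+ 1] covers the degenerate case [D = 0]. *)
      set (e := eps / (2 * D ^ 2 + 1)).
      assert (hD2 : 0 <= D ^ 2) by (unfold D; nra).
      assert (he : 0 < e) by (apply Rdiv_lt_0_compat; lra).
      destruct (@goursat_local f (X, Y) e) as [d [hd L]].
      { apply hf. split; simpl; unfold w, h in *; lra. }
      { exact he. }
      (* [D + 1] instead of [D] makes the inequality [D / 2 ^ n < d] strict. *)
      destruct (Pow_x_infinity 2 ltac:(rewrite Rabs_right; lra)
                  ((D + 1) / d)) as [N hN].
      exists N. intros n x y hn hxX hyY a1 a2 b1 b2.
      specialize (hN n hn). rewrite Rabs_right in hN by (specialize (pp n); lra).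
      assert (small : D / 2 ^ n < d).
      { apply Rmult_lt_reg_r with (2 ^ n); [apply pp|].
        unfold Rdiv. rewrite Rmult_assoc, Rinv_l by (specialize (pp n); lra).
        apply Rge_le in hN.
        apply (Rmult_le_compat_r d) in hN; [|lra].
        replace ((D + 1) / d * d) with (D + 1) in hN by (field; lra). lra. }
      assert (ES : x + w / 2 ^ n - x + (y + h / 2 ^ n - y) = D / 2 ^ n)
        by (unfold D; field; specialize (pp n); lra).
      eapply Rle_trans.
      + apply L.
        * now split.
        * rewrite ES. exact small.
        * apply cont_sides_on_rect.
          { specialize (pos w n hw); lra. }
          { specialize (pos h n hh); lra. }
          intros z [hz1 hz2]. apply Choloc_cont, hf. split; lra.
      + rewrite ES.
        replace (2 * e * (D / 2 ^ n) ^ 2) with (e * (2 * D ^ 2) / (2 ^ n) ^ 2)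
          by (field; specialize (pp n); lra).
        apply Rmult_le_compat_r.
        { left. apply Rinv_0_lt_compat. apply pow_lt, pp. }
        replace eps with (e * (2 * D ^ 2 + 1)) by (unfold e; field; lra).
        apply Rmult_le_compat_l; lra. }
  unfold P in H. simpl pow in H.
  replace (x1 + w / 1) with x2 in H by (unfold w; field).
  replace (y1 + h / 1) with y2 in H by (unfold h; field).
  replace (eps / (1 * (1 * 1))) with eps in H by field.
  apply H; lra.
Qed.

(** * Simple poles *)

(** The frame around the square splits into two full-height strips, left and right, and two blocks,
    below and above. None contains [a], so each integral vanishes by Goursat. *)
Lemma rectint_shrink (f : C -> C) (a : C) (x1 x2 y1 y2 s : R) :
  0 < s -> x1 < fst a - s -> fst a + s < x2 ->
  y1 < snd a - s -> snd a + s < y2 ->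
  (forall z, on_rect x1 x2 y1 y2 z -> z <> a -> Choloc f z) ->
  cont_sides f x1 x2 y1 y2 /\
  rectint f x1 x2 y1 y2
  = rectint f (fst a - s) (fst a + s) (snd a - s) (snd a + s).
Proof.
  destruct a as [p q]; simpl. intros hs h1 h2 h3 h4 hf.
  assert (off : forall x y, x1 <= x <= x2 -> y1 <= y <= y2 ->
      x <> p \/ y <> q -> Choloc f (x, y)).
  { intros x y hx hy hne. apply hf; [split; simpl; lra|].
    intros E. inversion E. tauto. }
  assert (ho : forall u v k l, x1 <= u <= v -> v <= x2 -> y1 <= k <= l ->
      l <= y2 -> p < u \/ v < p \/ q < k \/ l < q ->
      cont_sides f u v k l /\ rectint f u v k l = 0%C).
  { intros u v k l a1 a2 a3 a4 hd.
    assert (H : forall z, on_rect u v k l z -> Choloc f z).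
    { intros [x y] [b1 b2]; simpl in *. apply off; lra. }
    split; [|apply goursat_rect; auto; lra].
    apply cont_sides_on_rect; try lra. intros z hz. now apply Choloc_cont, H. }
  assert (cS : cont_sides f (p - s) (p + s) (q - s) (q + s)).
  { split; intros t ht; split; apply Choloc_cont, off; lra. }
  destruct (ho x1 (p - s) y1 y2) as [c1 e1]; try lra.
  destruct (ho (p + s) x2 y1 y2) as [c2 e2]; try lra.
  destruct (ho (p - s) (p + s) y1 (q - s)) as [c3 e3]; try lra.
  destruct (ho (p - s) (p + s) (q + s) y2) as [c4 e4]; try lra.
  destruct (@rectint_vsplit f (p - s) (p + s) y1 (q - s) (q + s)) as [c5 e5];
    try lra; try assumption.
  destruct (@rectint_vsplit f (p - s) (p + s) y1 (q + s) y2) as [c6 e6];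
    try lra; try assumption.
  destruct (@rectint_hsplit f x1 (p - s) (p + s) y1 y2) as [c7 e7];
    try lra; try assumption.
  destruct (@rectint_hsplit f x1 (p + s) x2 y1 y2) as [c8 e8];
    try lra; try assumption.
  split; [exact c8|].
  rewrite e8, e7, e6, e5, e1, e2, e3, e4. ring.
Qed.

Lemma RInt_C_real (g : R -> C) (k : R -> R) (c : C) (a b v : R) :
  (forall t, g t = (RtoC (k t) * c)%C) -> is_RInt k a b v ->
  RInt (V := CV) g a b = (RtoC v * c)%C.
Proof.
  intros hg hk. apply (is_RInt_unique (V := CV)).
  apply (is_RInt_ext (V := CV) (fun t => (k t * fst c, k t * snd c))).
  { intros t _. rewrite hg. apply injective_projections; simpl; ring. }
  replace (RtoC v * c)%C with (v * fst c, v * snd c)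
    by (apply injective_projections; simpl; ring).
  apply (@is_RInt_fct_extend_pair R_NormedModule R_NormedModule); simpl.
  - apply (is_RInt_ext (fun t => scal (fst c) (k t))).
    { intros t _. unfold scal; simpl; unfold mult; simpl; ring. }
    rewrite Rmult_comm. apply (@is_RInt_scal R_NormedModule), hk.
  - apply (is_RInt_ext (fun t => scal (snd c) (k t))).
    { intros t _. unfold scal; simpl; unfold mult; simpl; ring. }
    rewrite Rmult_comm. apply (@is_RInt_scal R_NormedModule), hk.
Qed.

(** The primitive [2 atan ((t - p) / s)] runs from [- PI / 2] to [PI / 2]. *)
Lemma is_RInt_arctan (s p : R) :
  0 < s -> is_RInt (fun t => 2 * s / ((t - p) ^ 2 + s ^ 2)) (p - s) (p + s) PI.
Proof.
  intros hs.
  assert (hq : forall t, 0 < (t - p) ^ 2 + s ^ 2)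
    by (intros t; apply Rplus_le_lt_0_compat; [apply pow2_ge_0|now apply pow_lt]).
  replace PI with (minus (2 * atan ((p + s - p) / s))
                         (2 * atan ((p - s - p) / s))).
  2:{ replace ((p + s - p) / s) with 1 by (field; lra).
      replace ((p - s - p) / s) with (- (1)) by (field; lra).
      rewrite atan_opp, atan_1. unfold minus, plus, opp; simpl. field. }
  apply (is_RInt_derive (fun t => 2 * atan ((t - p) / s))).
  - intros t _. auto_derive; [exact I|]. specialize (hq t). field. split; [lra|].
    unfold Rsqr. nra.
  - intros t _. apply (@ex_derive_continuous R_AbsRing R_NormedModule).
    auto_derive. specialize (hq t). simpl in hq. lra.
Qed.

(** With [u] and [v] measured from the centre, [1 / (u - i s) - 1 / (u + i s) = 2 i s / (u^2 + s^2)]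
    and [1 / (s + i v) - 1 / (- s + i v) = 2 s / (s^2 + v^2)]: each pair of sides contributes
    [i PI], with no logarithm involved. *)
Lemma rectint_inv (a : C) (s : R) :
  0 < s ->
  rectint (fun z => / (z - a))%C (fst a - s) (fst a + s) (snd a - s) (snd a + s)
  = (2 * PI * Ci)%C.
Proof.
  intros hs. destruct a as [p q]; simpl. unfold rectint.
  assert (hq : forall t k, 0 < (t - k) ^ 2 + s ^ 2)
    by (intros t k; apply Rplus_le_lt_0_compat;
        [apply pow2_ge_0|now apply pow_lt]).
  rewrite (@RInt_C_real _ (fun t => 2 * s / ((t - p) ^ 2 + s ^ 2)) Ci _ _ PI).
  3: now apply is_RInt_arctan.
  2:{ intros t. specialize (hq t p).
      apply injective_projections; simpl; field; simpl in hq; nra. }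
  rewrite (@RInt_C_real _ (fun t => 2 * s / ((t - q) ^ 2 + s ^ 2)) 1%C _ _ PI).
  3: now apply is_RInt_arctan.
  2:{ intros t. specialize (hq t q).
      apply injective_projections; simpl; field; simpl in hq; nra. }
  ring.
Qed.

(** Replaces the Laurent expansion: the limit says that [f - rho / (z - a)] is [o(1 / |z - a|)], so
    its integral over a square of half-side [s] tends to 0 with [s], while the integral of [f] over
    that square does not depend on [s]. *)
Theorem residue_rect (f : C -> C) (a rho : C) (x1 x2 y1 y2 : R) :
  x1 < fst a < x2 -> y1 < snd a < y2 ->
  (forall z, on_rect x1 x2 y1 y2 z -> z <> a -> Choloc f z) ->
  Clim (fun z => (z - a) * f z)%C a rho ->
  cont_sides f x1 x2 y1 y2 /\
  rectint f x1 x2 y1 y2 = (2 * PI * Ci * rho)%C.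
Proof.
  intros hx hy hf hlim.
  set (s0 := Rmin (Rmin (fst a - x1) (x2 - fst a))
                  (Rmin (snd a - y1) (y2 - snd a))).
  assert (hs0 : 0 < s0) by (repeat apply Rmin_pos; lra).
  assert (b1 : s0 <= fst a - x1)
    by (eapply Rle_trans; [apply Rmin_l|apply Rmin_l]).
  assert (b2 : s0 <= x2 - fst a)
    by (eapply Rle_trans; [apply Rmin_l|apply Rmin_r]).
  assert (b3 : s0 <= snd a - y1)
    by (eapply Rle_trans; [apply Rmin_r|apply Rmin_l]).
  assert (b4 : s0 <= y2 - snd a)
    by (eapply Rle_trans; [apply Rmin_r|apply Rmin_r]).
  clearbody s0.
  assert (shr : forall s, 0 < s < s0 -> cont_sides f x1 x2 y1 y2 /\
    rectint f x1 x2 y1 y2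
    = rectint f (fst a - s) (fst a + s) (snd a - s) (snd a + s)).
  { intros s hs. apply rectint_shrink; try lra. exact hf. }
  split; [apply (shr (s0 / 2)); lra|].
  apply Ceq_minus, Cmod_eq_0.
  apply Rle_antisym; [|apply Cmod_ge_0]. apply le_epsilon. intros eps heps.
  rewrite Rplus_0_l.
  (* The remainder will be at most [eps / 8 / s] on a perimeter of length [8 s]. *)
  destruct (hlim (eps / 8)) as [d [hd H]]; [lra|].
  (* On the square [|z - a| <= 2 s < d]; the bound [s0 / 2] keeps the square strictly inside the
     rectangle. *)
  set (s := Rmin (d / 4) (s0 / 2)).
  assert (hs : 0 < s) by (apply Rmin_pos; lra).
  assert (hsd : s <= d / 4) by apply Rmin_l.
  assert (hss : s <= s0 / 2) by apply Rmin_r.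
  clearbody s.
  destruct (shr s) as [_ ->]; [lra|].
  assert (hole : forall z, on_rect x1 x2 y1 y2 z -> z <> a ->
    Choloc (fun z => f z + - rho * / (z - a))%C z).
  { intros z hz hne. destruct (hf z hz hne) as [l hl].
    assert (hi : Choloc (fun z => - rho * / (z - a))%C z).
    { apply Choloc_mult; [apply Choloc_const|].
      apply Choloc_inv; [now apply Cminus_eq_contra|].
      apply Choloc_minus; [apply Choloc_id|apply Choloc_const]. }
    destruct hi as [m hm]. eexists. exact (Cderiv_plus hl hm). }
  assert (hne : forall x y, (Rabs (x - fst a) = s \/ Rabs (y - snd a) = s) ->
                (x, y) <> a).
  { intros x y h E. rewrite <- E in h. simpl in h.
    rewrite !Rminus_diag, Rabs_R0 in h. lra. }
  assert (side : forall x y,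
    Rabs (x - fst a) <= s -> Rabs (y - snd a) <= s ->
    (Rabs (x - fst a) = s \/ Rabs (y - snd a) = s) ->
    Choloc f (x, y) /\ Choloc (fun z => / (z - a))%C (x, y) /\
    Cmod (f (x, y) + - rho * / ((x, y) - a)) <= eps / 8 / s).
  { intros x y h1 h2 h3. assert (hxy := hne x y h3).
    assert (g1 := Rabs_def2 (x - fst a) (2 * s) ltac:(lra)).
    assert (g2 := Rabs_def2 (y - snd a) (2 * s) ltac:(lra)).
    assert (hxya := Cminus_eq_contra _ _ hxy).
    split; [|split].
    - apply hf; [split; simpl; lra|exact hxy].
    - apply Choloc_inv; [exact hxya|].
      apply Choloc_minus; [apply Choloc_id|apply Choloc_const].
    - set (z := (x, y) : C) in *.
      replace (f z + - rho * / (z - a))%C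
        with (((z - a) * f z - rho) / (z - a))%C by (field; exact hxya).
      rewrite Cmod_div by exact hxya.
      assert (lo : s <= Cmod (z - a)).
      { destruct h3 as [<-|<-].
        - exact (Rabs_fst_Cmod (z - a)).
        - exact (Rabs_snd_Cmod (z - a)). }
      assert (hi : Cmod (z - a) < d).
      { eapply Rle_lt_trans; [apply Cmod_le_Rabs|]. simpl.
        unfold Rminus in *. lra. }
      assert (hb := H z hxy hi).
      apply Rmult_le_compat; [apply Cmod_ge_0| |lra|].
      + left. apply Rinv_0_lt_compat. lra.
      + apply Rinv_le_contravar; lra. }
  assert (sm : Rabs (fst a - s - fst a) = s /\ Rabs (fst a + s - fst a) = s
            /\ Rabs (snd a - s - snd a) = s /\ Rabs (snd a + s - snd a) = s).
  { repeat split; [rewrite Rabs_left|rewrite Rabs_right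
                  |rewrite Rabs_left|rewrite Rabs_right]; lra. }
  destruct sm as [sm1 [sm2 [sm3 sm4]]].
  assert (hor : forall x, fst a - s <= x <= fst a + s -> Rabs (x - fst a) <= s)
    by (intros x h; apply Rabs_le; lra).
  assert (ver : forall y, snd a - s <= y <= snd a + s -> Rabs (y - snd a) <= s)
    by (intros x h; apply Rabs_le; lra).
  assert (cf : cont_sides f (fst a - s) (fst a + s) (snd a - s) (snd a + s)).
  { split; intros t ht; split; apply Choloc_cont, side; auto; lra. }
  assert (ci : cont_sides (fun z => / (z - a))%C
                 (fst a - s) (fst a + s) (snd a - s) (snd a + s)).
  { split; intros t ht; split; apply Choloc_cont, side; auto; lra. }
  assert (cri : cont_sides (fun z => - rho * / (z - a))%C
                 (fst a - s) (fst a + s) (snd a - s) (snd a + s)).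
  { split; intros t ht; split; (apply Clim_mult; [apply Clim_const|]);
      now apply ci. }
  assert (E : (rectint f (fst a - s) (fst a + s) (snd a - s) (snd a + s)
               - 2 * PI * Ci * rho)%C
    = rectint (fun z => f z + - rho * / (z - a))%C
        (fst a - s) (fst a + s) (snd a - s) (snd a + s)).
  { rewrite rectint_plus by (try lra; assumption).
    rewrite rectint_scal by (try lra; assumption).
    rewrite rectint_inv by exact hs. ring. }
  rewrite E.
  replace eps with (2 * (fst a + s - (fst a - s) + (snd a + s - (snd a - s)))
                    * (eps / 8 / s)) by (field; lra).
  apply rectint_le; try lra.
  - now apply cont_sides_plus.
  - intros t ht; split; apply side; auto; lra.
  - intros t ht; split; apply side; auto; lra.
Qed.

(** * The kernel of the interpolation formula *)

(* [2 i sin (pi z)] *)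
Definition sin2i (z : C) : C :=
  (Cexp (Ci * PI * z) - Cexp (- (Ci * PI) * z))%C.

(** With [2 i sin (pi z)] for the sine, the derivative at an integer [k] is [2 pi i (-1)^k], which
    absorbs the [2 pi i] of the residue theorem. *)
Definition kernel (z : C) : C :=
  (z * ((2 * z - 1) * (2 * z + 1)) * sin2i z)%C.

Lemma Cexp_ipi (x y : R) :
  Cexp (Ci * PI * (x, y))%C
  = (exp (- (PI * y)) * cos (PI * x), exp (- (PI * y)) * sin (PI * x)).
Proof.
  unfold Cexp.
  replace (fst (Ci * PI * (x, y))%C) with (- (PI * y)) by (simpl; ring).
  replace (snd (Ci * PI * (x, y))%C) with (PI * x) by (simpl; ring).
  reflexivity.
Qed.

Lemma Cexp_mipi (x y : R) :
  Cexp (- (Ci * PI) * (x, y))%C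
  = (exp (PI * y) * cos (PI * x), - (exp (PI * y) * sin (PI * x))).
Proof.
  unfold Cexp.
  replace (fst (- (Ci * PI) * (x, y))%C) with (PI * y) by (simpl; ring).
  replace (snd (- (Ci * PI) * (x, y))%C) with (- (PI * x)) by (simpl; ring).
  rewrite cos_neg, sin_neg. apply injective_projections; simpl; ring.
Qed.

Lemma sin2i_coord (x y : R) :
  sin2i (x, y) = ((exp (- (PI * y)) - exp (PI * y)) * cos (PI * x),
                  (exp (- (PI * y)) + exp (PI * y)) * sin (PI * x)).
Proof.
  unfold sin2i. rewrite Cexp_ipi, Cexp_mipi.
  apply injective_projections; simpl; ring.
Qed.

(** The imaginary part forces [sin (PI x) = 0]; the cosine is then nonzero, and the real part forces
    [exp (- (PI y)) = exp (PI y)]. *)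
Lemma sin2i_eq_0 (z : C) : sin2i z = 0%C -> exists k : Z, z = RtoC (IZR k).
Proof.
  destruct z as [x y]. rewrite sin2i_coord. intros H.
  assert (H1 := f_equal fst H). assert (H2 := f_equal snd H). simpl in H1, H2.
  assert (p1 := exp_pos (- (PI * y))). assert (p2 := exp_pos (PI * y)).
  assert (hpi := PI_RGT_0).
  assert (hs : sin (PI * x) = 0).
  { destruct (Rmult_integral _ _ H2); [lra|assumption]. }
  destruct (sin_eq_0_0 _ hs) as [k hk]. exists k.
  assert (hx : x = IZR k).
  { apply (Rmult_eq_reg_l PI); lra. }
  assert (hc : cos (PI * x) <> 0).
  { intros h. assert (Q := sin2_cos2 (PI * x)). rewrite h, hs in Q.
    unfold Rsqr in Q. lra. }
  assert (hy : y = 0).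
  { destruct (Rmult_integral _ _ H1) as [h|h]; [|easy].
    assert (h' : - (PI * y) = PI * y) by (apply exp_inv; lra).
    apply (Rmult_eq_reg_l PI); lra. }
  now rewrite hx, hy.
Qed.

(** With [u], [v] the two real exponentials, [u v = 1], the squared modulus is
    [u^2 + v^2 - 2 + 4 sin^2 (PI x)]. It is [u^2 + v^2] when the squared sine is [1 / 2]. When
    [|y| >= 1], [E = exp (PI |y|) >= 2] gives [E^2 - 2 >= E^2 / 4]. *)
Lemma sin2i_lower (x y : R) :
  (sin (PI * x)) ^ 2 = 1 / 2 \/ 1 <= Rabs y ->
  exp (PI * Rabs y) / 2 <= Cmod (sin2i (x, y)).
Proof.
  intros H. rewrite sin2i_coord.
  set (E := exp (PI * Rabs y)). assert (hE : 0 < E) by apply exp_pos.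
  set (u := exp (- (PI * y))). set (v := exp (PI * y)).
  assert (huv : u * v = 1).
  { unfold u, v. rewrite <- exp_plus.
    replace (- (PI * y) + PI * y) with 0 by ring. apply exp_0. }
  assert (hsum : E ^ 2 <= u ^ 2 + v ^ 2).
  { assert (h : E = u \/ E = v).
    { unfold E, u, v. destruct (Rle_dec 0 y).
      - right. now rewrite Rabs_right by lra.
      - left. rewrite Rabs_left by lra. f_equal. ring. }
    destruct h as [<-| ->]; nra. }
  set (s := sin (PI * x)) in *. set (c := cos (PI * x)).
  assert (hsc : s ^ 2 + c ^ 2 = 1).
  { assert (Q := sin2_cos2 (PI * x)). unfold Rsqr in Q. unfold s, c. simpl.
    lra. }
  assert (N : Cmod ((u - v) * c, (u + v) * s) ^ 2
              = u ^ 2 + v ^ 2 - 2 + 4 * s ^ 2).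
  { rewrite Cmod2_alt. simpl Re. simpl Im.
    replace (((u - v) * c) ^ 2 + ((u + v) * s) ^ 2)
      with ((u ^ 2 + v ^ 2) * (s ^ 2 + c ^ 2) + 2 * (u * v) * (s ^ 2 - c ^ 2))
      by ring.
    rewrite hsc, huv. lra. }
  assert (hb : (E / 2) ^ 2 <= Cmod ((u - v) * c, (u + v) * s) ^ 2).
  { rewrite N. destruct H as [H|H].
    - rewrite H. nra.
    - assert (hE2 : 2 <= E).
      { assert (h := exp_ineq1_le (PI * Rabs y)). fold E in h.
        assert (hpi := PI2_1). unfold PI2 in hpi. nra. }
      nra. }
  apply Rsqr_incr_0; [unfold Rsqr; simpl in hb; lra|lra|apply Cmod_ge_0].
Qed.

Lemma Cderiv_scale (f : C -> C) (a z l : C) :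
  a <> 0%C -> Cderiv f (a * z)%C l -> Cderiv (fun w => f (a * w)%C) z (a * l)%C.
Proof.
  intros ha hf.
  assert (H : Cderiv (fun w => f (a * w + 0)%C) z (a * l)%C).
  { apply Cderiv_comp_affine; [exact ha|].
    now replace (a * z + 0)%C with (a * z)%C by ring. }
  eapply Clim_ext; [|exact H]. intros w hw; simpl.
  now rewrite !Cplus_0_r.
Qed.

Lemma ipi_neq_0 : (Ci * PI)%C <> 0%C.
Proof.
  apply Cmult_neq_0; [exact Ci_nz|]. intros h. apply RtoC_inj in h.
  assert (hpi := PI_RGT_0). lra.
Qed.

Lemma Cderiv_sin2i (z : C) :
  Cderiv sin2i z (Ci * PI * (Cexp (Ci * PI * z) + Cexp (- (Ci * PI) * z)))%C.
Proof.
  assert (h1 := ipi_neq_0).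
  assert (h2 : (- (Ci * PI))%C <> 0%C).
  { intros h. apply h1. replace (Ci * PI)%C with (- - (Ci * PI))%C by ring.
    rewrite h. ring. }
  replace (Ci * PI * _)%C
    with (Ci * PI * Cexp (Ci * PI * z)
          - - (Ci * PI) * Cexp (- (Ci * PI) * z))%C by ring.
  apply Cderiv_minus; apply Cderiv_scale; auto using Cderiv_Cexp.
Qed.

Lemma cos_nat_PI (n : nat) : cos (PI * INR n) = (-1) ^ n.
Proof.
  induction n as [|n IH]; [simpl; rewrite Rmult_0_r; apply cos_0|].
  rewrite S_INR, Rmult_plus_distr_l, Rmult_1_r, neg_cos, IH. simpl. ring.
Qed.

Lemma cos_Z_PI (k : Z) : cos (PI * IZR k) = powerRZ (-1) k.
Proof.
  destruct k as [|p|p].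
  - simpl. rewrite Rmult_0_r. apply cos_0.
  - simpl. rewrite <- cos_nat_PI, INR_IPR. reflexivity.
  - simpl. rewrite <- cos_nat_PI, INR_IPR, <- cos_neg.
    rewrite <- (cos_neg (PI * IPR p)).
    change (IZR (Z.neg p)) with (- IPR p).
    replace (- (PI * - IPR p)) with (PI * IPR p) by ring.
    rewrite cos_neg, <- INR_IPR, cos_nat_PI.
    assert (h : (-1) ^ Pos.to_nat p * (-1) ^ Pos.to_nat p = 1).
    { rewrite <- Rpow_mult_distr. replace (-1 * -1) with 1 by ring.
      apply pow1. }
    assert ((-1) ^ Pos.to_nat p <> 0) by (apply pow_nonzero; lra).
    apply (Rmult_eq_reg_l ((-1) ^ Pos.to_nat p)); [|assumption].
    rewrite h, Rinv_r; auto.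
Qed.

Lemma sin_Z_PI (k : Z) : sin (PI * IZR k) = 0.
Proof. apply sin_eq_0_1. exists k. ring. Qed.

Lemma sin2i_Z (k : Z) : sin2i (RtoC (IZR k)) = 0%C.
Proof.
  unfold RtoC. rewrite sin2i_coord, sin_Z_PI, !Rmult_0_r, Ropp_0, exp_0.
  apply injective_projections; simpl; ring.
Qed.

Lemma Clim_sin2i_Z (k : Z) :
  Clim (fun z => sin2i z / (z - IZR k))%C (IZR k)
    (2 * PI * Ci * powerRZ (-1) k)%C.
Proof.
  assert (H := Cderiv_sin2i (RtoC (IZR k))).
  replace (Ci * PI * _)%C with (2 * PI * Ci * powerRZ (-1) k)%C in H.
  - eapply Clim_ext; [|exact H]. intros w hw; simpl. rewrite sin2i_Z.
    unfold Cminus at 1. now rewrite Copp_0, Cplus_0_r.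
  - assert (E1 := Cexp_ipi (IZR k) 0). assert (E2 := Cexp_mipi (IZR k) 0).
    rewrite Rmult_0_r, Ropp_0, exp_0, cos_Z_PI, sin_Z_PI in E1.
    rewrite Rmult_0_r, exp_0, cos_Z_PI, sin_Z_PI in E2.
    change ((IZR k, 0) : C) with (RtoC (IZR k)) in E1, E2. rewrite E1, E2.
    apply injective_projections; simpl; ring.
Qed.

Lemma Choloc_kernel (z : C) : Choloc kernel z.
Proof.
  unfold kernel.
  assert (A : forall c, Choloc (fun w => 2 * w - c)%C z).
  { intros c. apply Choloc_minus; [|apply Choloc_const].
    apply Choloc_mult; [apply Choloc_const|apply Choloc_id]. }
  apply Choloc_mult.
  - apply Choloc_mult; [apply Choloc_id|]. apply Choloc_mult; [apply A|].
    destruct (A (- (1))%C) as [l hl]. exists l.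
    eapply Clim_ext; [|exact hl]. intros w hw; simpl. f_equal. ring.
  - eexists. apply Cderiv_sin2i.
Qed.

Lemma kernel_neq_0 (z : C) :
  (forall k : Z, z <> RtoC (IZR k)) -> z <> RtoC (1 / 2) -> z <> RtoC (- (1 / 2)) ->
  kernel z <> 0%C.
Proof.
  intros hZ h1 h2. unfold kernel.
  assert (two : RtoC 2 <> 0%C) by (intros h; apply RtoC_inj in h; lra).
  repeat apply Cmult_neq_0.
  - exact (hZ 0%Z).
  - intros h. apply h1. rewrite RtoC_div by lra.
    replace z with ((2 * z - 1 + 1) / 2)%C by (field; exact two).
    now rewrite h, Cplus_0_l.
  - intros h. apply h2. rewrite RtoC_opp, RtoC_div by lra.
    replace z with ((2 * z + 1 - 1) / 2)%C by (field; exact two).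
    rewrite h. field; exact two.
  - intros h. destruct (sin2i_eq_0 h) as [k hk]. exact (hZ k hk).
Qed.

(** Double angle formula: [cos (2 PI (n + 3/4)) = cos (3 PI / 2) = 0]. *)
Lemma sin_sq_3_4 (n : nat) :
  sin (PI * (INR n + 3 / 4)) ^ 2 = 1 / 2 /\
  sin (PI * (- INR n - 3 / 4)) ^ 2 = 1 / 2.
Proof.
  assert (h : sin (PI * (INR n + 3 / 4)) ^ 2 = 1 / 2).
  { assert (Q := cos_2a_sin (PI * (INR n + 3 / 4))).
    replace (2 * (PI * (INR n + 3 / 4))) with (3 * (PI / 2) + 2 * INR n * PI) in Q
      by field.
    rewrite cos_period, cos_3PI2 in Q. simpl. lra. }
  split; [exact h|].
  replace (PI * (- INR n - 3 / 4)) with (- (PI * (INR n + 3 / 4))) by ring.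
  rewrite sin_neg. lra.
Qed.

Lemma kernel_lower (n : nat) (x y : R) :
  (1 <= n)%nat ->
  ((x = INR n + 3 / 4 \/ x = - INR n - 3 / 4) \/ (y = INR n \/ y = - INR n)) ->
  INR n ^ 3 * (exp (PI * Rabs y) / 2) <= Cmod (kernel (x, y)).
Proof.
  intros hn hxy. apply le_INR in hn. simpl in hn.
  assert (hS : exp (PI * Rabs y) / 2 <= Cmod (sin2i (x, y))).
  { apply sin2i_lower. destruct (sin_sq_3_4 n) as [s1 s2].
    destruct hxy as [[-> | ->]|[-> | ->]]; auto; right.
    - rewrite Rabs_right; lra.
    - rewrite Rabs_left; lra. }
  set (N := INR n) in *.
  (* On vertical sides the real part of [b z + c] is large, on horizontal ones the imaginary part.
     For [b = 2] and [|c| = 1] the bound [2 N - 1] is at least [N], as [N >= 1]. *)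
  assert (far : forall c : R, Rabs c <= N + 3 / 4 -> forall b : R, 1 <= b ->
    b * N - Rabs c <= Cmod (RtoC b * (x, y) + RtoC c)).
  { intros c hc b hb.
    destruct hxy as [h|h].
    - eapply Rle_trans; [|apply Rabs_fst_Cmod]. simpl.
      replace (b * x - 0 * y + c) with (b * x + c) by ring.
      assert (T := Rabs_triang (b * x + c) (- c)).
      replace (b * x + c + - c) with (b * x) in T by ring.
      rewrite Rabs_Ropp, Rabs_mult, (Rabs_right b) in T by lra.
      assert (N <= Rabs x); [|nra].
      destruct h as [-> | ->]; [rewrite Rabs_right|rewrite Rabs_left]; lra.
    - eapply Rle_trans; [|apply Rabs_snd_Cmod]. simpl.
      replace (b * y + 0 * x + 0) with (b * y) by ring.
      rewrite Rabs_mult, (Rabs_right b) by lra.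
      assert (N <= Rabs y); [|assert (p := Rabs_pos c); nra].
      destruct h as [-> | ->]; [rewrite Rabs_right|rewrite Rabs_left]; lra. }
  set (z := (x, y) : C) in *.
  assert (f1 : N <= Cmod z).
  { assert (h := far 0 ltac:(rewrite Rabs_R0; lra) 1 ltac:(lra)).
    rewrite Rabs_R0 in h.
    replace (1 * z + 0)%C with z in h by ring. lra. }
  assert (f2 : N <= Cmod (2 * z - 1)).
  { assert (h := far (-1) ltac:(rewrite Rabs_left; lra) 2 ltac:(lra)).
    rewrite Rabs_left in h by lra.
    replace (2 * z + (-1)%R)%C with (2 * z - 1)%C in h by ring. lra. }
  assert (f3 : N <= Cmod (2 * z + 1)).
  { assert (h := far 1 ltac:(rewrite Rabs_right; lra) 2 ltac:(lra)).
    rewrite Rabs_right in h by lra. lra. }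
  unfold kernel. rewrite !Cmod_mult.
  assert (hE := exp_pos (PI * Rabs y)).
  replace (N ^ 3) with (N * (N * N)) by ring.
  repeat (apply Rmult_le_compat; try lra; try nra).
Qed.

(** Residue of [h / K] at a simple pole. The function [u] takes out a common zero of [h] and [K]: it
    is 1 at the ordinary poles and [z] at the origin, where [K] vanishes twice and [h] once. *)
Lemma Clim_pole (h K u : C -> C) (a l kappa : C) :
  (forall z, z <> a -> u z <> 0%C) -> kappa <> 0%C ->
  Clim (fun z => h z / u z)%C a l ->
  Clim (fun z => K z / (u z * (z - a)))%C a kappa ->
  Clim (fun z => (z - a) * (h z / K z))%C a (l / kappa)%C.
Proof.
  intros hu hk hh hK.
  destruct (Clim_neq_0 hk hK) as [d [hd hne]].
  eapply Clim_ext_loc; [exact hd| |exact (Clim_div hk hh hK)].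
  intros z hz hzd; simpl.
  assert (h1 := hu z hz). assert (h2 := Cminus_eq_contra _ _ hz).
  assert (h3 : K z <> 0%C).
  { intros e. apply (hne z hz hzd). rewrite e. field. now split. }
  field. repeat split; assumption.
Qed.

Lemma Clim_lin (b c z : C) : Clim (fun w => b * w + c)%C z (b * z + c)%C.
Proof.
  apply Clim_plus; [|apply Clim_const].
  apply Clim_mult; [apply Clim_const|apply Clim_id].
Qed.

Lemma Ccont_sin2i (z : C) : Ccont sin2i z.
Proof. exact (Cderiv_cont (Cderiv_sin2i z)). Qed.

Lemma two_pi_i_neq_0 : (2 * PI * Ci)%C <> 0%C.
Proof.
  replace (2 * PI * Ci)%C with (2 * (Ci * PI))%C by ring.
  apply Cmult_neq_0; [|exact ipi_neq_0]. intros h; apply RtoC_inj in h; lra.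
Qed.

Lemma powerRZ_m1_sq (k : Z) : powerRZ (-1) k * powerRZ (-1) k = 1.
Proof.
  assert (Q := sin2_cos2 (PI * IZR k)).
  rewrite sin_Z_PI, cos_Z_PI in Q. unfold Rsqr in Q. lra.
Qed.

(** The shape of [series_term] in the normalised coordinate, with nodes at the integers. *)
Definition interp_term (h : C -> C) (k : Z) : C :=
  (RtoC (powerRZ (-1) k) * h (RtoC (IZR k)) / RtoC (IZR (k * (4 * k ^ 2 - 1))))%C.

Lemma denom_factor (k : Z) :
  RtoC (IZR (k * (4 * k ^ 2 - 1)))
  = (IZR k * ((2 * IZR k + - (1)) * (2 * IZR k + 1)))%C.
Proof.
  rewrite <- !RtoC_mult, <- RtoC_opp, <- !RtoC_plus, <- !RtoC_mult. f_equal.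
  rewrite mult_IZR, minus_IZR, mult_IZR, Z.pow_2_r, mult_IZR. ring.
Qed.

(** The true order is [|k|^3]; the square is enough for the telescoping majorant. *)
Lemma denom_ge (k : Z) : k <> 0%Z -> (IZR k) ^ 2 <= Rabs (IZR (k * (4 * k ^ 2 - 1))).
Proof.
  intros hk. rewrite <- abs_IZR.
  replace (IZR k ^ 2) with (IZR (k ^ 2)) by (rewrite Z.pow_2_r, mult_IZR; ring).
  apply IZR_le. rewrite Z.abs_mul, Z.pow_2_r. nia.
Qed.

Lemma denom_neq_0 (k : Z) : k <> 0%Z -> RtoC (IZR (k * (4 * k ^ 2 - 1))) <> 0%C.
Proof.
  intros hk h. apply RtoC_inj in h. assert (Q := denom_ge hk).
  rewrite h, Rabs_R0 in Q. assert (IZR k <> 0) by now apply not_0_IZR. nra.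
Qed.

(** * The interpolation formula by residues *)

Section Interp.

Variables (h : C -> C) (d : C) (A : R).
Hypothesis hol : forall z, Choloc h z.
Hypothesis h0 : h 0%C = 0%C.
Hypothesis hd : Cderiv h 0%C d.
Hypothesis hA : forall z, Cmod (h z) <= A * exp (PI * Rabs (snd z)).

Let phi (z : C) : C := (h z / kernel z)%C.

Lemma Clim_pole_Z (k : Z) : k <> 0%Z ->
  Clim (fun z => (z - IZR k) * phi z)%C (IZR k)
    (interp_term h k / (2 * PI * Ci))%C.
Proof.
  intros hk. assert (hp := powerRZ_m1_sq k).
  assert (hp0 : RtoC (powerRZ (-1) k) <> 0%C)
    by (intros e; apply RtoC_inj in e; rewrite e in hp; lra).
  assert (hD := denom_neq_0 hk). assert (h2 := two_pi_i_neq_0).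
  set (kappa := (RtoC (IZR (k * (4 * k ^ 2 - 1)))
                 * (2 * PI * Ci * powerRZ (-1) k))%C).
  assert (hkap : kappa <> 0%C)
    by (apply Cmult_neq_0; [exact hD|apply Cmult_neq_0; assumption]).
  replace (interp_term h k / (2 * PI * Ci))%C with (h (IZR k) / 1 / kappa)%C.
  - apply (@Clim_pole h kernel (fun _ => 1%C)).
    + intros _ _. exact C1_nz.
    + exact hkap.
    + apply Clim_mult; [apply Choloc_cont, hol|apply Clim_const].
    + unfold kappa. rewrite denom_factor.
      apply Clim_ext with (fun z =>
        (z * ((2 * z + - (1)) * (2 * z + 1))) * (sin2i z / (z - IZR k)))%C.
      { intros z hz. unfold kernel. field; now apply Cminus_eq_contra. }
      apply Clim_mult; [|apply Clim_sin2i_Z].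
      apply Clim_mult; [apply Clim_id|]. apply Clim_mult; apply Clim_lin.
  (* The sign [(-1)^k] is its own inverse, so it passes from the derivative of the sine to the
     numerator of the term. *)
  - assert (E : (/ RtoC (powerRZ (-1) k))%C = RtoC (powerRZ (-1) k)).
    { rewrite <- (Cmult_1_l (/ _)%C).
      replace (RtoC 1) with (RtoC (powerRZ (-1) k) * RtoC (powerRZ (-1) k))%C
        by now rewrite <- RtoC_mult, hp.
      field. exact hp0. }
    unfold interp_term, kappa. rewrite <- E at 2.
    set (D := RtoC (IZR (k * (4 * k ^ 2 - 1)))) in *.
    set (tp := (2 * PI * Ci)%C) in *. field. repeat split; assumption.
Qed.

(** One zero of [kernel] is compensated by [h 0 = 0], which turns [h z / z] into the derivative [d];
    the minus sign is the value of [(2 z - 1) (2 z + 1)] at 0. *)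
Lemma Clim_pole_0 :
  Clim (fun z => (z - 0) * phi z)%C 0%C (- d / (2 * PI * Ci))%C.
Proof.
  assert (h2 := two_pi_i_neq_0).
  replace (- d / (2 * PI * Ci))%C with (d / - (2 * PI * Ci))%C
    by (set (tp := (2 * PI * Ci)%C) in *; field; exact h2).
  apply (@Clim_pole h kernel (fun z => z - 0)%C).
  - intros z hz. now apply Cminus_eq_contra.
  - intros e. apply h2. replace (2 * PI * Ci)%C with (- - (2 * PI * Ci))%C by ring.
    rewrite e. ring.
  - eapply Clim_ext; [|exact hd]. intros z hz; simpl. rewrite h0.
    f_equal. ring.
  - replace (- (2 * PI * Ci))%C
      with (((2 * 0 + - (1)) * (2 * 0 + 1)) * (2 * PI * Ci * powerRZ (-1) 0))%C
      by (simpl; ring).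
    apply Clim_ext with (fun z =>
      ((2 * z + - (1)) * (2 * z + 1)) * (sin2i z / (z - 0)))%C.
    { intros z hz. unfold kernel. replace (z - 0)%C with z by ring. field.
      exact hz. }
    apply Clim_mult; [|apply (Clim_sin2i_Z 0)].
    apply Clim_mult; apply Clim_lin.
Qed.

Lemma sin2i_half : sin2i (RtoC (1 / 2)) = (2 * Ci)%C /\
                   sin2i (RtoC (- (1 / 2))) = (- (2 * Ci))%C.
Proof.
  split; unfold RtoC; rewrite sin2i_coord, Rmult_0_r, Ropp_0, exp_0.
  - replace (PI * (1 / 2)) with (PI / 2) by field. rewrite sin_PI2.
    apply injective_projections; simpl; ring.
  - replace (PI * - (1 / 2)) with (- (PI / 2)) by field.
    rewrite sin_neg, sin_PI2. apply injective_projections; simpl; ring.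
Qed.

(** Here the zero comes from [2 z - 1 = 2 (z - 1/2)], and the sine contributes [2 i]. The remaining
    factor is [4 i], and [1 / (4 i) = (PI / 2) / (2 PI i)]. *)
Lemma Clim_pole_half :
  Clim (fun z => (z - RtoC (1 / 2)) * phi z)%C (RtoC (1 / 2))
    (PI / 2 * h (RtoC (1 / 2)) / (2 * PI * Ci))%C.
Proof.
  set (a := RtoC (1 / 2)).
  assert (two : RtoC 2 <> 0%C) by (intros e; apply RtoC_inj in e; lra).
  assert (hpi : RtoC PI <> 0%C)
    by (intros e; apply RtoC_inj in e; assert (p := PI_RGT_0); lra).
  assert (ha : a = (/ 2)%C).
  { unfold a. rewrite RtoC_div by lra. field; exact two. }
  assert (E : (PI / 2 * h a / (2 * PI * Ci) = h a / 1 / (4 * Ci))%C).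
  { field; repeat split; auto using Ci_nz;
    intros e; apply RtoC_inj in e; lra. }
  rewrite E.
  apply (@Clim_pole h kernel (fun _ => 1%C)).
  - intros _ _. exact C1_nz.
  - apply Cmult_neq_0; [|exact Ci_nz]. intros e; apply RtoC_inj in e; lra.
  - apply Clim_mult; [apply Choloc_cont, hol|apply Clim_const].
  - replace (4 * Ci)%C with ((a * (2 * (2 * a + 1))) * sin2i a)%C.
    2:{ unfold a at 3. rewrite (proj1 sin2i_half). rewrite ha.
        field; exact two. }
    apply Clim_ext with (fun z => (z * (2 * (2 * z + 1))) * sin2i z)%C.
    { intros z hz. unfold kernel.
      replace (2 * z - 1)%C with (2 * (z - a))%C by (rewrite ha; field; exact two).
      field; now apply Cminus_eq_contra. }
    apply Clim_mult; [|apply Ccont_sin2i].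
    apply Clim_mult; [apply Clim_id|].
    apply Clim_mult; [apply Clim_const|apply Clim_lin].
Qed.

Lemma Clim_pole_mhalf :
  Clim (fun z => (z - RtoC (- (1 / 2))) * phi z)%C (RtoC (- (1 / 2)))
    (- (PI / 2 * h (RtoC (- (1 / 2)))) / (2 * PI * Ci))%C.
Proof.
  set (a := RtoC (- (1 / 2))).
  assert (two : RtoC 2 <> 0%C) by (intros e; apply RtoC_inj in e; lra).
  assert (hpi : RtoC PI <> 0%C)
    by (intros e; apply RtoC_inj in e; assert (p := PI_RGT_0); lra).
  assert (ha : a = (- / 2)%C).
  { unfold a. rewrite RtoC_opp, RtoC_div by lra. field; exact two. }
  assert (E : (- (PI / 2 * h a) / (2 * PI * Ci) = h a / 1 / (- (4) * Ci))%C).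
  { field; repeat split; auto using Ci_nz;
    rewrite <- ?RtoC_opp; intros e; apply RtoC_inj in e; lra. }
  rewrite E.
  apply (@Clim_pole h kernel (fun _ => 1%C)).
  - intros _ _. exact C1_nz.
  - apply Cmult_neq_0; [|exact Ci_nz]. rewrite <- RtoC_opp.
    intros e; apply RtoC_inj in e; lra.
  - apply Clim_mult; [apply Choloc_cont, hol|apply Clim_const].
  - replace (- (4) * Ci)%C with ((a * ((2 * a + - (1)) * 2)) * sin2i a)%C.
    2:{ unfold a at 3. rewrite (proj2 sin2i_half). rewrite ha.
        field; exact two. }
    apply Clim_ext with (fun z => (z * ((2 * z + - (1)) * 2)) * sin2i z)%C.
    { intros z hz. unfold kernel.
      replace (2 * z + 1)%C with (2 * (z - a))%C by (rewrite ha; field; exact two).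
      field; now apply Cminus_eq_contra. }
    apply Clim_mult; [|apply Ccont_sin2i].
    apply Clim_mult; [apply Clim_id|].
    apply Clim_mult; [apply Clim_lin|apply Clim_const].
Qed.

(** All zeros of [kernel] are real, so a strip isolates [a] as soon as its projection to the real
    axis meets no other integer or half [1/2], [-1/2]. *)
Lemma strip_residue (a x1 x2 Y : R) (v : C) :
  0 < Y -> x1 < a < x2 ->
  (forall m : Z, x1 <= IZR m <= x2 -> IZR m = a) ->
  (x1 <= 1 / 2 <= x2 -> 1 / 2 = a) ->
  (x1 <= - (1 / 2) <= x2 -> - (1 / 2) = a) ->
  Clim (fun z => (z - a) * phi z)%C a (v / (2 * PI * Ci))%C ->
  cont_sides phi x1 x2 (- Y) Y /\ rectint phi x1 x2 (- Y) Y = v.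
Proof.
  intros hY ha hZ hp hm hl. assert (h2 := two_pi_i_neq_0).
  destruct (@residue_rect phi a (v / (2 * PI * Ci))%C x1 x2 (- Y) Y)
    as [c e]; simpl; try lra; try exact hl.
  - intros z [hz _] hne. unfold phi.
    apply Choloc_mult; [apply hol|].
    apply Choloc_inv; [|apply Choloc_kernel].
    apply kernel_neq_0.
    + intros k ->. apply hne. simpl in hz. now rewrite (hZ k hz).
    + intros ->. apply hne. simpl in hz. now rewrite (hp hz).
    + intros ->. apply hne. simpl in hz. now rewrite (hm hz).
  - split; [exact c|]. rewrite e.
    set (tp := (2 * PI * Ci)%C) in *. field. exact h2.
Qed.

(** * Tiling of the box by vertical strips with one pole each *)

Lemma IZR_between (m k : Z) : IZR k - 1 < IZR m < IZR k + 1 -> m = k.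
Proof.
  intros [a b].
  assert (a' : (k - 1 < m)%Z) by (apply lt_IZR; rewrite minus_IZR; exact a).
  assert (b' : (m < k + 1)%Z) by (apply lt_IZR; rewrite plus_IZR; exact b).
  lia.
Qed.

(** Unit strips [[k - 1/4, k + 3/4]], one for each [k] from 1 to [n + 1]. They start at [3/4], which
    leaves the pole [1/2] to the middle part. *)
Lemma rectint_right (Y : R) (n : nat) : 0 < Y ->
  cont_sides phi (3 / 4) (INR (S n) + 3 / 4) (- Y) Y /\
  rectint phi (3 / 4) (INR (S n) + 3 / 4) (- Y) Y
  = sum_n_m (G := C_AbelianMonoid) (fun j => interp_term h (Z.of_nat j)) 1 (S n).
Proof.
  intros hY.
  assert (one : forall k, (1 <= k)%nat ->
    cont_sides phi (INR k - 1 / 4) (INR k + 3 / 4) (- Y) Y /\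
    rectint phi (INR k - 1 / 4) (INR k + 3 / 4) (- Y) Y
    = interp_term h (Z.of_nat k)).
  { intros k hk. apply le_INR in hk. simpl in hk.
    rewrite INR_IZR_INZ in *.
    apply (@strip_residue (IZR (Z.of_nat k))); try lra.
    - intros m hm. f_equal. apply IZR_between. lra.
    - apply Clim_pole_Z. intros e. rewrite e in hk. lra. }
  induction n as [|n [c e]].
  - destruct (one 1%nat (le_n _)) as [c e].
    replace (INR 1 - 1 / 4) with (3 / 4) in c, e by (simpl; lra).
    split; [exact c|]. rewrite e, sum_n_n. reflexivity.
  - destruct (one (S (S n)) ltac:(lia)) as [c2 e2].
    assert (p := pos_INR n).
    rewrite S_INR in c2, e2.
    replace (INR (S n) + 1 - 1 / 4) with (INR (S n) + 3 / 4) in c2, e2 by lra.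
    rewrite (S_INR (S n)).
    assert (q := S_INR n).
    destruct (@rectint_hsplit phi (3 / 4) (INR (S n) + 3 / 4)
                (INR (S n) + 1 + 3 / 4) (- Y) Y) as [c3 e3];
      try lra; try assumption.
    split; [exact c3|]. rewrite e3, e, e2.
    rewrite (@sum_n_Sm C_AbelianMonoid _ 1 (S n)) by lia. reflexivity.
Qed.

Lemma rectint_left (Y : R) (n : nat) : 0 < Y ->
  cont_sides phi (- INR (S n) - 3 / 4) (- (3 / 4)) (- Y) Y /\
  rectint phi (- INR (S n) - 3 / 4) (- (3 / 4)) (- Y) Y
  = sum_n_m (G := C_AbelianMonoid)
      (fun j => interp_term h (- Z.of_nat j)) 1 (S n).
Proof.
  intros hY.
  assert (one : forall k, (1 <= k)%nat ->
    cont_sides phi (- INR k - 3 / 4) (- INR k + 1 / 4) (- Y) Y /\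
    rectint phi (- INR k - 3 / 4) (- INR k + 1 / 4) (- Y) Y
    = interp_term h (- Z.of_nat k)).
  { intros k hk. apply le_INR in hk. simpl in hk.
    rewrite INR_IZR_INZ in *. rewrite <- opp_IZR.
    assert (hk' : IZR (- Z.of_nat k) <= -1) by (rewrite opp_IZR; lra).
    apply (@strip_residue (IZR (- Z.of_nat k))); try lra.
    - intros m hm. f_equal. apply IZR_between. lra.
    - apply Clim_pole_Z. intros e. rewrite e in hk'. lra. }
  induction n as [|n [c e]].
  - destruct (one 1%nat (le_n _)) as [c e].
    replace (- INR 1 + 1 / 4) with (- (3 / 4)) in c, e by (simpl; lra).
    split; [exact c|]. rewrite e, sum_n_n. reflexivity.
  - destruct (one (S (S n)) ltac:(lia)) as [c2 e2].
    assert (p := pos_INR n).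
    rewrite S_INR in c2, e2.
    replace (- (INR (S n) + 1) + 1 / 4) with (- INR (S n) - 3 / 4) in c2, e2
      by lra.
    rewrite (S_INR (S n)).
    assert (q := S_INR n).
    destruct (@rectint_hsplit phi (- (INR (S n) + 1) - 3 / 4)
                (- INR (S n) - 3 / 4) (- (3 / 4)) (- Y) Y) as [c3 e3];
      try lra; try assumption.
    split; [exact c3|]. rewrite e3, e, e2.
    rewrite (@sum_n_Sm C_AbelianMonoid _ 1 (S n)) by lia.
    rewrite Cplus_comm. reflexivity.
Qed.

(** Three strips of width [1/2] around [-1/2], 0 and [1/2]. *)
Lemma rectint_middle (Y : R) : 0 < Y ->
  cont_sides phi (- (3 / 4)) (3 / 4) (- Y) Y /\
  rectint phi (- (3 / 4)) (3 / 4) (- Y) Y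
  = (PI / 2 * (h (RtoC (1 / 2)) - h (RtoC (- (1 / 2)))) - d)%C.
Proof.
  intros hY.
  destruct (@strip_residue (- (1 / 2)) (- (3 / 4)) (- (1 / 4)) Y
    (- (PI / 2 * h (RtoC (- (1 / 2)))))%C) as [c1 e1]; try lra.
  { intros m hm. exfalso.
    assert (a : (-1 < m)%Z) by (apply lt_IZR; lra).
    assert (b : (m < 0)%Z) by (apply lt_IZR; lra). lia. }
  { exact Clim_pole_mhalf. }
  destruct (@strip_residue 0 (- (1 / 4)) (1 / 4) Y (- d)%C) as [c2 e2]; try lra.
  { intros m hm. assert (m = 0)%Z by (apply IZR_between; lra). now subst. }
  { exact Clim_pole_0. }
  destruct (@strip_residue (1 / 2) (1 / 4) (3 / 4) Y
    (PI / 2 * h (RtoC (1 / 2)))%C) as [c3 e3]; try lra.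
  { intros m hm. exfalso.
    assert (a : (0 < m)%Z) by (apply lt_IZR; lra).
    assert (b : (m < 1)%Z) by (apply lt_IZR; lra). lia. }
  { exact Clim_pole_half. }
  destruct (@rectint_hsplit phi (- (3 / 4)) (- (1 / 4)) (1 / 4) (- Y) Y)
    as [c4 e4]; try lra; try assumption.
  destruct (@rectint_hsplit phi (- (3 / 4)) (1 / 4) (3 / 4) (- Y) Y)
    as [c5 e5]; try lra; try assumption.
  split; [exact c5|]. rewrite e5, e4, e1, e2, e3. ring.
Qed.

(** The difference on the left is exactly the integral of [phi] over the whole box, all residues
    being collected. *)
Lemma interp_partial (n : nat) :
  Cmod (zsum (G := C_AbelianMonoid) (interp_term h) (S n) (S n)
        - (d - PI / 2 * (h (RtoC (1 / 2)) - h (RtoC (- (1 / 2))))))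
  <= 24 * A / INR (S n).
Proof.
  set (N := INR (S n)). assert (hN : 1 <= N).
  { unfold N. rewrite S_INR. assert (p := pos_INR n). lra. }
  assert (hN0 : 0 < N) by lra.
  destruct (rectint_left n hN0) as [c1 e1]. destruct (rectint_middle hN0) as [c2 e2].
  destruct (rectint_right n hN0) as [c3 e3]. fold N in c1, c3, e1, e3.
  destruct (@rectint_hsplit phi (- N - 3 / 4) (- (3 / 4)) (3 / 4) (- N) N)
    as [c4 e4]; try lra; try assumption.
  destruct (@rectint_hsplit phi (- N - 3 / 4) (3 / 4) (N + 3 / 4) (- N) N)
    as [c5 e5]; try lra; try assumption.
  rewrite e4, e1, e2, e3 in e5.
  match goal with |- Cmod ?x <= _ =>
    replace x with (rectint phi (- N - 3 / 4) (N + 3 / 4) (- N) N) end.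
  2:{ rewrite e5. unfold zsum.
      change (@plus C_AbelianMonoid) with Cplus. ring. }
  assert (hA0 : 0 <= A).
  { assert (q := hA 0%C). simpl in q. rewrite Rabs_R0, Rmult_0_r, exp_0 in q.
    assert (r := Cmod_ge_0 (h 0%C)). lra. }
  assert (B : forall x y,
     ((x = N + 3 / 4 \/ x = - N - 3 / 4) \/ (y = N \/ y = - N)) ->
     Cmod (phi (x, y)) <= 2 * A / N ^ 3).
  { intros x y hxy. assert (hk := @kernel_lower (S n) x y ltac:(lia) hxy).
    fold N in hk. assert (hh := hA (x, y)). simpl snd in hh.
    assert (hE := exp_pos (PI * Rabs y)). set (E := exp (PI * Rabs y)) in *.
    assert (hN3 : 0 < N ^ 3) by (apply pow_lt; lra).
    assert (hpos : 0 < N ^ 3 * (E / 2)) by (apply Rmult_lt_0_compat; lra).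
    unfold phi. rewrite Cmod_div by (apply Cmod_gt_0; lra).
    replace (2 * A / N ^ 3) with (A * E / (N ^ 3 * (E / 2))) by (field; lra).
    apply Rmult_le_compat; [apply Cmod_ge_0| |exact hh|].
    - left. apply Rinv_0_lt_compat. lra.
    - apply Rinv_le_contravar; assumption. }
  eapply Rle_trans.
  { apply (@rectint_le phi _ _ _ _ (2 * A / N ^ 3)); try lra; try exact c5.
    - intros x hx. split; apply B; tauto.
    - intros y hy. split; apply B; tauto. }
  (* Perimeter [8 N + 3] times [2 A / N^3] is [(16 N + 6) A / N^3], well below [24 A / N] because
     [N >= 1]. *)
  replace (24 * A / N) with (24 * A * N ^ 2 / N ^ 3) by (field; lra).
  unfold Rdiv. rewrite <- !Rmult_assoc.
  apply Rmult_le_compat_r.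
  { left. apply Rinv_0_lt_compat, pow_lt. lra. }
  assert (hAN : 0 <= A * (N - 1)) by (apply Rmult_le_pos; lra).
  assert (hAN2 : 0 <= A * (N - 1) * N) by (apply Rmult_le_pos; lra).
  nra.
Qed.

End Interp.

(** * Series over the nonzero integers with terms O(1/k^2) *)

Lemma minus_plus_l (G : AbelianGroup) (a b : G) : minus (plus a b) a = b.
Proof.
  change (plus (plus a b) (opp a) = b). rewrite (plus_comm a), <- plus_assoc.
  rewrite plus_opp_r. apply plus_zero_r.
Qed.

Lemma minus_plus_plus (G : AbelianGroup) (a b c d : G) :
  minus (plus a b) (plus c d) = plus (minus a c) (minus b d).
Proof.
  change (plus (plus a b) (opp (plus c d))
          = plus (plus a (opp c)) (plus b (opp d))).
  rewrite opp_plus, <- !plus_assoc. f_equal.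
  rewrite !plus_assoc. f_equal. apply plus_comm.
Qed.

(** Telescoping, by [1 / (m + 1)^2 <= 1 / m - 1 / (m + 1)]. *)
Lemma sum_inv_sq_tail (V : NormedModule R_AbsRing) (b : nat -> V) (M : R)
  (n k : nat) :
  (1 <= n)%nat -> (forall j, (1 <= j)%nat -> norm (b j) <= M / INR j ^ 2) ->
  norm (sum_n_m b (S n) (n + k)) <= M / INR n - M / INR (n + k).
Proof.
  intros hn hb. induction k as [|k IH].
  - rewrite Nat.add_0_r, sum_n_m_zero by lia. rewrite norm_zero. lra.
  - rewrite Nat.add_succ_r, sum_n_Sm by lia.
    eapply Rle_trans; [apply norm_triangle|].
    assert (h := hb (S (n + k)) ltac:(lia)).
    assert (hM : 0 <= M).
    { assert (q := hb 1%nat (le_n _)). simpl in q.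
      assert (p := norm_ge_0 (b 1%nat)). lra. }
    assert (hp : 1 <= INR (n + k)) by (apply (le_INR 1); lia).
    rewrite S_INR in *. set (m := INR (n + k)) in *.
    assert (M / (m + 1) ^ 2 <= M / m - M / (m + 1)); [|lra].
    replace (M / m - M / (m + 1)) with (M * / (m * (m + 1))) by (field; lra).
    apply Rmult_le_compat_l; [exact hM|].
    apply Rinv_le_contravar; nra.
Qed.

Lemma sum_inv_sq_cauchy (V : NormedModule R_AbsRing) (b : nat -> V) (M : R)
  (N m n : nat) :
  (1 <= N)%nat -> (N <= m)%nat -> (N <= n)%nat ->
  (forall j, (1 <= j)%nat -> norm (b j) <= M / INR j ^ 2) ->
  norm (minus (sum_n_m b 1 m) (sum_n_m b 1 n)) <= M / INR N.
Proof.
  intros hN hm hn hb.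
  assert (hM : 0 <= M).
  { assert (q := hb 1%nat (le_n _)). simpl in q.
    assert (p := norm_ge_0 (b 1%nat)). lra. }
  assert (A : forall i j, (N <= i)%nat -> (i <= j)%nat ->
    norm (minus (sum_n_m b 1 j) (sum_n_m b 1 i)) <= M / INR N).
  { intros i j hi hij.
    rewrite (sum_n_m_Chasles b 1 i j) by lia.
    rewrite (minus_plus_l (sum_n_m b 1 i)).
    replace j with (i + (j - i))%nat by lia.
    eapply Rle_trans; [apply (sum_inv_sq_tail (M := M)); [lia|exact hb]|].
    assert (1 <= INR N) by (apply (le_INR 1); lia).
    assert (INR N <= INR i) by (apply le_INR; lia).
    assert (INR i <= INR (i + (j - i))) by (apply le_INR; lia).
    assert (0 <= M / INR (i + (j - i))).
    { apply Rmult_le_pos; [exact hM|]. left. apply Rinv_0_lt_compat. lra. }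
    assert (M / INR i <= M / INR N); [|lra].
    apply Rmult_le_compat_l; [exact hM|]. apply Rinv_le_contravar; lra. }
  destruct (Nat.le_gt_cases m n) as [h|h].
  - rewrite <- norm_opp, opp_minus. apply A; lia.
  - apply A; lia.
Qed.

(** The bound depends on the terms only through [M], which is the source of uniformity. *)
Lemma zsum_cauchy (V : NormedModule R_AbsRing) (a : Z -> V) (M : R)
  (N m n m' n' : nat) :
  (1 <= N)%nat -> (N <= m)%nat -> (N <= n)%nat -> (N <= m')%nat ->
  (N <= n')%nat ->
  (forall k, k <> 0%Z -> norm (a k) <= M / IZR k ^ 2) ->
  norm (minus (zsum a m n) (zsum a m' n')) <= 2 * (M / INR N).
Proof.
  intros hN h1 h2 h3 h4 ha. unfold zsum.
  rewrite minus_plus_plus.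
  eapply Rle_trans; [apply norm_triangle|].
  replace (2 * (M / INR N)) with (M / INR N + M / INR N) by ring.
  apply Rplus_le_compat; apply sum_inv_sq_cauchy; auto; intros j hj.
  - rewrite INR_IZR_INZ. replace (IZR (Z.of_nat j) ^ 2)
      with (IZR (- Z.of_nat j) ^ 2) by (rewrite opp_IZR; ring).
    apply ha. lia.
  - rewrite INR_IZR_INZ. apply ha. lia.
Qed.

Lemma ex_tail_small (M eps : R) :
  0 < eps -> exists N, (1 <= N)%nat /\ 2 * (M / INR N) < eps.
Proof.
  (* [Rabs M + 1] keeps the denominator positive whatever [M] is. *)
  intros heps. destruct (archimed_cor1 (eps / (2 * (Rabs M + 1)))) as [N [h1 h2]].
  { apply Rdiv_lt_0_compat; [exact heps|]. assert (p := Rabs_pos M). lra. }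
  exists N; split; [lia|].
  assert (p := Rabs_pos M). assert (q := Rle_abs M).
  assert (hi : 0 < / INR N) by (apply Rinv_0_lt_compat, lt_0_INR; exact h2).
  apply (Rmult_lt_compat_r (2 * (Rabs M + 1))) in h1; [|lra].
  replace (eps / (2 * (Rabs M + 1)) * (2 * (Rabs M + 1))) with eps in h1
    by (field; lra).
  unfold Rdiv. nra.
Qed.

Lemma ex_zseries (V : CompleteNormedModule R_AbsRing) (a : Z -> V) (M : R) :
  (forall k, k <> 0%Z -> norm (a k) <= M / IZR k ^ 2) ->
  exists l, is_zseries a l.
Proof.
  intros ha. unfold is_zseries.
  apply (@filterlim_locally_cauchy _ (CompleteNormedModule.CompleteSpace _ V)
           (filter_prod eventually eventually) _
           (fun mn : nat * nat => zsum a (fst mn) (snd mn))).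
  intros eps.
  destruct (ex_tail_small M (cond_pos eps)) as [N [hN hs]].
  exists (fun mn : nat * nat => (N <= fst mn)%nat /\ (N <= snd mn)%nat). split.
  - exists (fun m => (N <= m)%nat) (fun m => (N <= m)%nat);
      [now exists N|now exists N|]. intros m n hm hn; simpl; now split.
  - intros [m n] [m' n'] [h1 h2] [h3 h4]; simpl fst in *; simpl snd in *.
    apply (@norm_compat1 R_AbsRing V). eapply Rle_lt_trans; [|exact hs].
    apply (@zsum_cauchy V); assumption.
Qed.

Lemma is_zseries_norm (V : NormedModule R_AbsRing) (a : Z -> V) (l : V)
  (eps : R) :
  is_zseries a l -> 0 < eps ->
  exists N, forall m n, (N <= m)%nat -> (N <= n)%nat ->
    norm (minus (zsum a m n) l) < eps.
Proof.
  intros ha heps.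
  destruct (proj1 (filterlim_locally_ball_norm _ _) ha (mkposreal eps heps))
    as [Q R [N1 h1] [N2 h2] H].
  exists (Nat.max N1 N2). intros m n hm hn.
  apply (H m n); [apply h1|apply h2]; lia.
Qed.

Lemma zseries_cv_abs (X : Type) (E : X -> Prop) (u : Z -> X -> C) (M : R) :
  (forall k x, k <> 0%Z -> E x -> Cmod (u k x) <= M / IZR k ^ 2) ->
  zseries_cv_abs_on E u.
Proof.
  intros hu x hx.
  apply (@ex_zseries R_CompleteNormedModule _ M). intros k hk.
  change (Rabs (Cmod (u k x)) <= M / IZR k ^ 2).
  rewrite Rabs_right by apply Rle_ge, Cmod_ge_0. now apply hu.
Qed.

Lemma zseries_cv_unif (X : Type) (E : X -> Prop) (u : Z -> X -> C) (M : R) :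
  (forall k x, k <> 0%Z -> E x -> Cmod (u k x) <= M / IZR k ^ 2) ->
  zseries_cv_unif_on E u.
Proof.
  intros hu.
  assert (hn : forall x, E x -> forall k, k <> 0%Z ->
    norm (V := C_R_NormedModule) (u k x) <= M / IZR k ^ 2).
  { intros x hx k hk. rewrite norm_C_R. now apply hu. }
  set (L := fun x l => is_zseries (V := C_R_NormedModule) (fun k => u k x) l).
  (* The pointwise sum is selected by choice; the default 0 is taken off [E] at points where no sum
     exists. *)
  exists (fun x => epsilon (inhabits (RtoC 0)) (L x)). intros eps heps.
  destruct (@ex_tail_small M (eps / 2)) as [N [hN hs]]; [lra|].
  exists N. intros m n hm hn' x hx.
  assert (hl : L x (epsilon (inhabits (RtoC 0)) (L x))).
  { apply epsilon_spec. exact (@ex_zseries CV _ M (hn x hx)). }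
  set (l := epsilon (inhabits (RtoC 0)) (L x)) in *.
  destruct (@is_zseries_norm _ _ _ (eps / 2) hl) as [N' H]; [lra|].
  (* The auxiliary index [p] depends on [x] and only serves to pass from the Cauchy bound to the
     limit; [N] depends on [M] and [eps] alone. *)
  set (p := Nat.max N N').
  assert (h1 := H p p ltac:(lia) ltac:(lia)).
  assert (h2 := @zsum_cauchy C_R_NormedModule _ M N m n p p hN hm hn'
                  ltac:(lia) ltac:(lia) (hn x hx)).
  rewrite norm_C_R in h1, h2.
  change (@zsum (NormedModule.AbelianMonoid R_AbsRing C_R_NormedModule))
    with (@zsum C_AbelianMonoid) in h1, h2.
  change (@minus (NormedModule.AbelianGroup R_AbsRing C_R_NormedModule))
    with Cminus in h1, h2.
  set (a := zsum (fun k => u k x) m n) in *.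
  set (b := zsum (fun k => u k x) p p) in *.
  replace (a - l)%C with ((a - b) + (b - l))%C by ring.
  eapply Rle_lt_trans; [apply Cmod_triangle|]. lra.
Qed.

(** * From polar-analytic to entire functions *)

Lemma Clim_unique (f : C -> C) (z l m : C) : Clim f z l -> Clim f z m -> l = m.
Proof.
  intros hl hm. apply Ceq_minus, Cmod_eq_0.
  apply Rle_antisym; [|apply Cmod_ge_0]. apply le_epsilon. intros eps heps.
  destruct (hl (eps / 2)) as [d1 [hd1 h1]]; [lra|].
  destruct (hm (eps / 2)) as [d2 [hd2 h2]]; [lra|].
  set (e := Rmin d1 d2 / 2).
  assert (he0 : 0 < Rmin d1 d2) by now apply Rmin_pos.
  assert (he : 0 < e) by (unfold e; lra).
  assert (e1 : e < d1) by (assert (q := Rmin_l d1 d2); unfold e; lra).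
  assert (e2 : e < d2) by (assert (q := Rmin_r d1 d2); unfold e; lra).
  assert (hc : Cmod (z + RtoC e - z) = e).
  { replace (z + RtoC e - z)%C with (RtoC e) by ring.
    rewrite Cmod_R. apply Rabs_right. lra. }
  assert (hz : (z + RtoC e)%C <> z).
  { intros E. rewrite E in hc. replace (z - z)%C with (RtoC 0) in hc by ring.
    rewrite Cmod_0 in hc. lra. }
  assert (g1 := h1 _ hz ltac:(rewrite hc; exact e1)).
  assert (g2 := h2 _ hz ltac:(rewrite hc; exact e2)).
  set (w := f (z + RtoC e)%C) in *.
  replace (l - m)%C with (- (w - l) + (w - m))%C by ring.
  eapply Rle_trans; [apply Cmod_triangle|]. rewrite Cmod_opp. lra.
Qed.

Lemma polar_exp (x y : R) : polar (exp x) y = Cexp (x, y).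
Proof.
  unfold polar, Cexp. apply injective_projections; simpl; ring.
Qed.

(** The global chart [z = ln r + i t] of the Riemann surface of the logarithm: the angle is not
    periodic, so no branch has to be chosen. *)
Definition logpolar (f : R -> R -> C) (z : C) : C := f (exp (fst z)) (snd z).

Lemma is_Dpol_eps (f : R -> R -> C) (r t : R) (l : C) (eps : R) :
  is_Dpol f r t l -> 0 < eps -> exists d, 0 < d /\
  forall r' t', Rabs (r' - r) < d -> Rabs (t' - t) < d -> (r', t') <> (r, t) ->
    Cmod ((f r' t' - f r t) / (polar r' t' - polar r t) - l) < eps.
Proof.
  intros hl heps.
  (* Balls in [C] control the two coordinates separately, hence half of [eps] for each. *)
  assert (he : 0 < eps / 2) by lra.
  destruct (proj1 (filterlim_locally _ _) hl (mkposreal _ he)) as [d hd].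
  exists d; split; [apply cond_pos|]. intros r' t' hr ht hne.
  destruct (hd (r', t') (conj hr ht) hne) as [h1 h2].
  change (Rabs (fst ((f r' t' - f r t) / (polar r' t' - polar r t))%C - fst l)
          < eps / 2) in h1.
  change (Rabs (snd ((f r' t' - f r t) / (polar r' t' - polar r t))%C - snd l)
          < eps / 2) in h2.
  eapply Rle_lt_trans; [apply Cmod_le_Rabs|].
  set (q := ((f r' t' - f r t) / (polar r' t' - polar r t))%C) in *.
  change (Rabs (fst q - fst l) + Rabs (snd q - snd l) < eps). lra.
Qed.

(** Chain rule through the exponential: the denominators of the polar quotient are
    [Cexp w - Cexp z], nonzero for [w] near [z] because the derivative of [Cexp] does not vanish. *)
Lemma Cderiv_logpolar (f : R -> R -> C) (x y : R) (l : C) :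
  is_Dpol f (exp x) y l -> Cderiv (logpolar f) (x, y) (Cexp (x, y) * l)%C.
Proof.
  intros hl. set (z := (x, y) : C).
  assert (hE := Cderiv_Cexp z). assert (hn := @Cexp_neq_0 z).
  destruct (Clim_neq_0 hn hE) as [d [hd hne]].
  apply (@Clim_ext_loc (fun w => (Cexp w - Cexp z) / (w - z)
    * ((logpolar f w - logpolar f z) / (Cexp w - Cexp z)))%C _ z _ d hd).
  { intros w hw hwd. assert (h1 := Cminus_eq_contra _ _ hw).
    assert (h2 : (Cexp w - Cexp z)%C <> 0%C).
    { intros e. apply (hne w hw hwd). rewrite e. field. exact h1. }
    field. now split. }
  apply Clim_mult; [exact hE|].
  intros eps heps. destruct (is_Dpol_eps hl heps) as [d1 [hd1 h1]].
  destruct (derivable_continuous_pt exp x (derivable_pt_exp x) d1 hd1)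
    as [d2 [hd2 h2]].
  exists (Rmin d1 d2); split; [now apply Rmin_pos|].
  intros w hw hwd. destruct w as [u v].
  assert (b1 := Rmin_l d1 d2). assert (b2 := Rmin_r d1 d2).
  assert (hu := Rabs_fst_Cmod ((u, v) - z)%C).
  assert (hv := Rabs_snd_Cmod ((u, v) - z)%C).
  change (fst ((u, v) - z)%C) with (u - x) in hu.
  change (snd ((u, v) - z)%C) with (v - y) in hv.
  unfold z. rewrite <- !polar_exp. apply h1.
  - destruct (Req_dec x u) as [<-|hxu].
    + rewrite Rminus_diag, Rabs_R0. exact hd1.
    + apply h2. split; [split; [exact I|exact hxu]|].
      change (Rabs (u - x) < d2). lra.
  - lra.
  - intros e. apply hw. unfold z. injection e as e1 e2.
    now rewrite (exp_inv _ _ e1), e2.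
Qed.

(** Uniqueness of the polar limit, which gives [iota] its meaning, is read off from that of the
    derivative of [logpolar f] after division by [Cexp z]. *)
Lemma Dpol_unique (f : R -> R -> C) (r t : R) (l : C) :
  0 < r -> is_Dpol f r t l -> Dpol f r t = l.
Proof.
  intros hr hl. unfold Dpol. apply (@iota_unique _ CV); [|exact hl].
  intros m hm. rewrite <- (exp_ln r hr) in hl, hm.
  assert (h1 := Clim_unique (Cderiv_logpolar hl) (Cderiv_logpolar hm)).
  assert (hn := @Cexp_neq_0 (ln r, t)).
  apply (f_equal (Cmult (/ Cexp (ln r, t)))) in h1.
  rewrite !Cmult_assoc, (Cinv_l _ hn), !Cmult_1_l in h1. now symmetry.
Qed.

(** * The interpolation formula on the polar plane *)

Lemma Rabs_powerRZ_m1 (k : Z) : Rabs (powerRZ (-1) k) = 1.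
Proof.
  assert (h := powerRZ_m1_sq k). assert (p := Rabs_pos (powerRZ (-1) k)).
  assert (q : Rabs (powerRZ (-1) k) * Rabs (powerRZ (-1) k) = 1)
    by now rewrite <- Rabs_mult, h, Rabs_R1.
  nra.
Qed.

Lemma Rpower_mult_exp (r c s : R) :
  0 < r -> Rpower (r * exp s) c = Rpower r c * exp (s * c).
Proof.
  intros hr. unfold Rpower. rewrite ln_mult, ln_exp by (try apply exp_pos; exact hr).
  rewrite <- exp_plus. f_equal. ring.
Qed.

Lemma exp_le_compat (x y : R) : x <= y -> exp x <= exp y.
Proof. intros [h|<-]; [left; now apply exp_increasing|lra]. Qed.

(** The exponential weight of the term turns [r^c] into the power of the shifted radius
    [r exp (k PI / T)]. The angle does not move, so the growth bound there is independent of [r] and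
    [k]. *)
Lemma Cmod_series_term (c T : R) (f : R -> R -> C) (Cf : R) (k : Z) (r t : R) :
  (forall r t, 0 < r -> Rpower r c * Cmod (f r t) <= Cf * exp (T * Rabs t)) ->
  0 < r -> k <> 0%Z ->
  Rpower r c * Cmod (series_term c T f k r t)
  <= Cf * exp (T * Rabs t) / IZR k ^ 2.
Proof.
  intros hf hr hk. unfold series_term.
  rewrite Cmod_div by now apply denom_neq_0.
  rewrite Cmod_mult, !Cmod_R, Rabs_mult, Rabs_powerRZ_m1, Rmult_1_l.
  rewrite Rabs_right by (left; apply exp_pos).
  set (s := IZR k * PI / T).
  replace (IZR k * PI * c / T) with (s * c) by (unfold s, Rdiv; ring).
  assert (hd := denom_ge hk).
  assert (hk2 : 0 < IZR k ^ 2).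
  { assert (IZR k <> 0) by now apply not_0_IZR. nra. }
  assert (hB := hf (r * exp s) t (Rmult_lt_0_compat _ _ hr (exp_pos s))).
  rewrite Rpower_mult_exp in hB by exact hr.
  unfold Rdiv. rewrite <- Rmult_assoc.
  apply Rmult_le_compat.
  - apply Rmult_le_pos; [left; apply exp_pos|].
    apply Rmult_le_pos; [left; apply exp_pos|apply Cmod_ge_0].
  - left. apply Rinv_0_lt_compat. lra.
  - rewrite <- Rmult_assoc. exact hB.
  - apply Rinv_le_contravar; assumption.
Qed.

Lemma zsum_sym (a : Z -> C) (n : nat) :
  zsum (G := C_AbelianMonoid) a n n
  = sum_n_m (G := C_AbelianMonoid)
      (fun j => a (- Z.of_nat j)%Z + a (Z.of_nat j))%C 1 n.
Proof.
  unfold zsum. symmetry.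
  exact (@sum_n_m_plus C_AbelianMonoid (fun j => a (- Z.of_nat j)%Z)
           (fun j => a (Z.of_nat j)) 1 n).
Qed.

(* The weights [(-1)^k / (k (4 k^2 - 1))] are odd in [k], so the sum of a
   constant cancels. *)
Lemma zsum_interp_shift (h : C -> C) (v : C) (n : nat) :
  zsum (G := C_AbelianMonoid) (interp_term (fun w => h w - v)%C) n n
  = zsum (G := C_AbelianMonoid) (interp_term h) n n.
Proof.
  rewrite !zsum_sym. apply sum_n_m_ext_loc. intros j [hj _].
  set (k := Z.of_nat j). assert (hk : k <> 0%Z) by (unfold k; lia).
  unfold interp_term.
  replace (- k * (4 * (- k) ^ 2 - 1))%Z with (- (k * (4 * k ^ 2 - 1)))%Z
    by (rewrite !Z.pow_2_r; ring).
  assert (ep : powerRZ (-1) (- k) = powerRZ (-1) k).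
  { rewrite <- !cos_Z_PI, opp_IZR, Ropp_mult_distr_r_reverse. apply cos_neg. }
  match goal with |- ?u = ?v => change (@eq C u v) end.
  rewrite ep, (opp_IZR (k * _)%Z), RtoC_opp.
  assert (hD := denom_neq_0 hk).
  set (D := RtoC (IZR (k * (4 * k ^ 2 - 1)))) in *.
  set (p := RtoC (powerRZ (-1) k)). field. exact hD.
Qed.

Lemma Mellin_Bernstein_interp (c T : R) (f : R -> R -> C) (r t : R) (S : C) :
  0 < T -> Mellin_Bernstein c T f -> 0 < r ->
  is_zseries (V := C_R_NormedModule) (fun k => series_term c T f k r t) S ->
  Theta c f r t =
    (RtoC (T / 2)
       * (RtoC (exp (PI * c / (2 * T))) * f (r * exp (PI / (2 * T)))%R t
          - RtoC (exp (- (PI * c) / (2 * T)))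
            * f (r * exp (- PI / (2 * T)))%R t)
     + RtoC (T / PI) * S)%C.
Proof.
  intros hT [han [_ [Cf [hCf hf]]]] hr hS.
  assert (hpi := PI_RGT_0).
  destruct (han r t hr) as [l hl].
  set (q := PI / T). assert (hq : 0 < q) by now apply Rdiv_lt_0_compat.
  assert (hqC : RtoC q <> 0%C) by (intros e; apply RtoC_inj in e; lra).
  (* The weight is [e^(c (z - z0))], with [z0] the point [ln r + i t], so that [h1] takes the value
     [f r t] at 0. The [+ 0] fits the affine chain rule. *)
  set (h1 := fun w : C =>
    (Cexp (RtoC c * (RtoC q * w + 0)) * logpolar f (RtoC q * w + (ln r, t)))%C).
  assert (val : forall x y, h1 (x, y) =
    (Cexp ((c * (q * x))%R, (c * (q * y))%R) * f (r * exp (q * x))%R (t + q * y)%R)%C).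
  { intros x y. unfold h1, logpolar. f_equal.
    - f_equal. apply injective_projections; simpl; ring.
    - f_equal; simpl; [|ring].
      replace (q * x - 0 * y + ln r) with (ln r + q * x) by ring.
      rewrite exp_plus, exp_ln by exact hr. reflexivity. }
  assert (valR : forall x : R, h1 (RtoC x)
    = (RtoC (exp (c * (q * x))) * f (r * exp (q * x))%R t)%C).
  { intros x. unfold RtoC at 1. rewrite val.
    rewrite !Rmult_0_r, Rplus_0_r. f_equal.
    apply (Cexp_R (c * (q * x))). }
  assert (val0 : h1 0%C = f r t).
  { rewrite valR, !Rmult_0_r, exp_0, Rmult_1_r. ring. }
  assert (hexp : forall z, Cderiv (fun w => Cexp (RtoC c * w)%C) z
                   (RtoC c * Cexp (RtoC c * z))%C).
  { intros z. destruct (Ceq_dec (RtoC c) 0%C) as [e|ne].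
    - rewrite e. replace (0 * Cexp (0 * z))%C with (RtoC 0) by ring.
      apply Clim_ext with (fun w =>
        ((fun _ => 1%C) w - (fun _ => 1%C) z) / (w - z))%C.
      { intros w hw. rewrite !Cmult_0_l, Cexp_0. reflexivity. }
      apply Cderiv_const.
    - apply Cderiv_scale; [exact ne|apply Cderiv_Cexp]. }
  assert (der1 : forall z l', is_Dpol f (exp (fst (RtoC q * z + (ln r, t))%C))
      (snd (RtoC q * z + (ln r, t))%C) l' ->
    Cderiv h1 z
      (RtoC q * (RtoC c * Cexp (RtoC c * (RtoC q * z + 0)))
         * logpolar f (RtoC q * z + (ln r, t))
       + Cexp (RtoC c * (RtoC q * z + 0))
         * (RtoC q * (Cexp (RtoC q * z + (ln r, t)) * l')))%C).
  { intros z l' hl'.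
    apply (@Cderiv_mult (fun w => Cexp (RtoC c * (RtoC q * w + 0))%C)
             (fun w => logpolar f (RtoC q * w + (ln r, t))%C)).
    - apply (@Cderiv_comp_affine (fun w => Cexp (RtoC c * w)%C)); auto.
    - apply (@Cderiv_comp_affine (logpolar f)); [exact hqC|].
      assert (H := Cderiv_logpolar hl').
      now rewrite <- surjective_pairing in H. }
  assert (hol1 : forall z, Choloc h1 z).
  { intros z. destruct (han (exp (fst (RtoC q * z + (ln r, t))%C))
      (snd (RtoC q * z + (ln r, t))%C) (exp_pos _)) as [l' hl'].
    eexists. apply der1, hl'. }
  set (h := fun w => (h1 w - h1 0%C)%C).
  set (d := (RtoC q * Theta c f r t)%C).
  assert (hd : Cderiv h 0%C d).
  { replace d with (d - 0)%C by ring.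
    apply Cderiv_minus; [|apply Cderiv_const].
    assert (e0 : (RtoC q * 0 + (ln r, t))%C = (ln r, t))
      by (apply injective_projections; simpl; ring).
    assert (H := @der1 0%C l). rewrite e0 in H. simpl fst in H. simpl snd in H.
    rewrite exp_ln in H by exact hr. specialize (H hl).
    replace d with (RtoC q * (RtoC c * Cexp (RtoC c * (RtoC q * 0 + 0)))
         * logpolar f (ln r, t)
       + Cexp (RtoC c * (RtoC q * 0 + 0))
         * (RtoC q * (Cexp (ln r, t) * l)))%C; [exact H|].
    replace (RtoC c * (RtoC q * 0 + 0))%C with (RtoC 0) by ring.
    rewrite Cexp_0. unfold d, Theta. rewrite (Dpol_unique hr hl).
    rewrite <- polar_exp. unfold logpolar. simpl fst. simpl snd.
    rewrite exp_ln by exact hr. ring. }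
  assert (hRp : 0 < Rpower r c) by apply exp_pos.
  (* This constant depends on the base point, which is harmless since the formula is proved
     pointwise; [T q = PI] gives the type. *)
  set (A := Cf * exp (T * Rabs t) / Rpower r c).
  assert (hA1 : forall z, Cmod (h1 z) <= A * exp (PI * Rabs (snd z))).
  { intros [x y]. rewrite val, Cmod_mult, Cmod_Cexp. simpl fst. simpl snd.
    assert (hB := hf (r * exp (q * x)) (t + q * y)
                    (Rmult_lt_0_compat _ _ hr (exp_pos (q * x)))).
    rewrite Rpower_mult_exp in hB by exact hr.
    assert (hm : exp (T * Rabs (t + q * y))
                 <= exp (T * Rabs t) * exp (PI * Rabs y)).
    { rewrite <- exp_plus. apply exp_le_compat.
      assert (Q := Rabs_triang t (q * y)).
      rewrite Rabs_mult, (Rabs_right q) in Q by lra.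
      replace (PI * Rabs y) with (T * (q * Rabs y)) by (unfold q; field; lra).
      nra. }
    apply Rmult_le_reg_l with (Rpower r c); [exact hRp|].
    replace (Rpower r c * (A * exp (PI * Rabs y)))
      with (Cf * (exp (T * Rabs t) * exp (PI * Rabs y)))
      by (unfold A; field; lra).
    replace (c * (q * x)) with (q * x * c) by ring.
    rewrite <- Rmult_assoc. eapply Rle_trans; [exact hB|].
    apply Rmult_le_compat_l; lra. }
  assert (hA0 : Cmod (h1 0%C) <= A).
  { assert (Q := hA1 0%C). simpl in Q.
    rewrite Rabs_R0, Rmult_0_r, exp_0, Rmult_1_r in Q. exact Q. }
  assert (hA : forall z, Cmod (h z) <= 2 * A * exp (PI * Rabs (snd z))).
  { intros z. unfold h, Cminus.
    eapply Rle_trans; [apply Cmod_triangle|]. rewrite Cmod_opp.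
    assert (Q := hA1 z). assert (Q0 := Cmod_ge_0 (h1 0%C)).
    assert (1 <= exp (PI * Rabs (snd z))).
    { rewrite <- exp_0. apply exp_le_compat.
      apply Rmult_le_pos; [lra|apply Rabs_pos]. }
    nra. }
  assert (hol : forall z, Choloc h z).
  { intros z. apply Choloc_minus; [apply hol1|apply Choloc_const]. }
  assert (h0 : h 0%C = 0%C) by (unfold h; ring).
  assert (P := interp_partial hol h0 hd hA).
  assert (Et : forall k, interp_term h1 k = series_term c T f k r t).
  { intros k. unfold interp_term, series_term. rewrite valR, RtoC_mult.
    unfold q.
    replace (c * (PI / T * IZR k)) with (IZR k * PI * c / T) by (field; lra).
    replace (PI / T * IZR k) with (IZR k * PI / T) by (field; lra).
    f_equal. ring. }
  set (L := (d - PI / 2 * (h (RtoC (1 / 2)) - h (RtoC (- (1 / 2)))))%C) in *.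
  (* The given sum [S] and the contour value [L] are both limits of the symmetric partial sums. *)
  assert (SL : S = L).
  { apply Ceq_minus, Cmod_eq_0.
    apply Rle_antisym; [|apply Cmod_ge_0]. apply le_epsilon. intros eps heps.
    destruct (@is_zseries_norm _ _ _ (eps / 2) hS) as [N1 H1]; [lra|].
    (* The factor 2 supplied by [ex_tail_small] completes [12] to the [24] of [interp_partial];
       [2 A] is the growth constant of [h]. *)
    destruct (@ex_tail_small (12 * (2 * A)) (eps / 2)) as [N2 [hN2 H2]]; [lra|].
    set (n := Nat.max N1 N2).
    assert (g1 := H1 (Datatypes.S n) (Datatypes.S n) ltac:(lia) ltac:(lia)).
    rewrite norm_C_R in g1.
    change (@zsum (NormedModule.AbelianMonoid R_AbsRing C_R_NormedModule))
      with (@zsum C_AbelianMonoid) in g1.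
    change (@minus (NormedModule.AbelianGroup R_AbsRing C_R_NormedModule))
      with Cminus in g1.
    assert (g2 := P n). unfold h at 1 in g2. rewrite zsum_interp_shift in g2.
    assert (Ez : zsum (G := C_AbelianMonoid) (interp_term h1)
                   (Datatypes.S n) (Datatypes.S n)
      = zsum (G := C_AbelianMonoid) (fun k => series_term c T f k r t)
          (Datatypes.S n) (Datatypes.S n)).
    { unfold zsum. f_equal; apply sum_n_m_ext; intros j; apply Et. }
    rewrite Ez in g2.
    set (Z := zsum (fun k => series_term c T f k r t)
                (Datatypes.S n) (Datatypes.S n)) in *.
    assert (hA00 : 0 <= A) by (eapply Rle_trans; [apply Cmod_ge_0|exact hA0]).
    assert (g3 : 24 * (2 * A) / INR (Datatypes.S n) <= 2 * (12 * (2 * A) / INR N2)).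
    { replace (2 * (12 * (2 * A) / INR N2)) with (24 * (2 * A) / INR N2)
        by (unfold Rdiv; ring).
      apply Rmult_le_compat_l; [lra|]. apply Rinv_le_contravar.
      - apply lt_0_INR. lia.
      - apply le_INR. lia. }
    replace (S - L)%C with (- (Z - S) + (Z - L))%C by ring.
    eapply Rle_trans; [apply Cmod_triangle|]. rewrite Cmod_opp. lra. }
  assert (hv : (h (RtoC (1 / 2)) - h (RtoC (- (1 / 2))))%C
    = (RtoC (exp (PI * c / (2 * T))) * f (r * exp (PI / (2 * T)))%R t
       - RtoC (exp (- (PI * c) / (2 * T)))
         * f (r * exp (- PI / (2 * T)))%R t)%C).
  { unfold h. rewrite !valR. unfold q.
    replace (c * (PI / T * (1 / 2))) with (PI * c / (2 * T)) by (field; lra).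
    replace (c * (PI / T * - (1 / 2))) with (- (PI * c) / (2 * T)) by (field; lra).
    replace (PI / T * (1 / 2)) with (PI / (2 * T)) by (field; lra).
    replace (PI / T * - (1 / 2)) with (- PI / (2 * T)) by (field; lra).
    ring. }
  (* As [d] is [(PI / T)] times the derivative sought, multiplying [L] by [T / PI] isolates it and
     turns [PI / 2] into [T / 2]. *)
  rewrite <- hv, SL. unfold L, d, q.
  assert (hTC : RtoC T <> 0%C) by (intros e; apply RtoC_inj in e; lra).
  assert (hPC : RtoC PI <> 0%C) by (intros e; apply RtoC_inj in e; lra).
  assert (two : RtoC 2 <> 0%C) by (intros e; apply RtoC_inj in e; lra).
  rewrite !RtoC_div by lra. field. repeat split; assumption.
Qed.

Theorem corollary3 (c T : R) (f : R -> R -> C) (hT : 0 < T)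
  (hf : Mellin_Bernstein c T f) :
  (forall r t : R, 0 < r ->
     exists S : C,
       is_zseries (V := C_R_NormedModule) (fun k => series_term c T f k r t) S
       /\ Theta c f r t =
          (RtoC (T / 2)
             * (RtoC (exp (PI * c / (2 * T))) * f (r * exp (PI / (2 * T)))%R t
                - RtoC (exp (- (PI * c) / (2 * T)))
                  * f (r * exp (- PI / (2 * T)))%R t)
           + RtoC (T / PI) * S)%C)
  /\ (forall a b : R, a < b ->
        zseries_cv_abs_on (strip a b)
          (fun k p => (RtoC (Rpower (fst p) c)
                       * series_term c T f k (fst p) (snd p))%C)
        /\ zseries_cv_unif_on (strip a b)
          (fun k p => (RtoC (Rpower (fst p) c)
                       * series_term c T f k (fst p) (snd p))%C)).
Proof.
  assert (hf' := hf). destruct hf' as [_ [_ [Cf [hCf hb]]]]. split.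
  - intros r t hr.
    assert (hR : 0 < Rpower r c) by apply exp_pos.
    (* For a fixed point the weight [r^c] of the estimate is divided out of the majorant. *)
    destruct (@ex_zseries CV (fun k => series_term c T f k r t)
                (Cf * exp (T * Rabs t) / Rpower r c)) as [S hS].
    { intros k hk.
      change (norm (V := C_R_NormedModule) (series_term c T f k r t)
              <= Cf * exp (T * Rabs t) / Rpower r c / IZR k ^ 2).
      rewrite norm_C_R.
      apply Rmult_le_reg_l with (Rpower r c); [exact hR|].
      assert (IZR k <> 0) by now apply not_0_IZR.
      replace (Rpower r c * (Cf * exp (T * Rabs t) / Rpower r c / IZR k ^ 2))
        with (Cf * exp (T * Rabs t) / IZR k ^ 2) by (field; split; lra).
      now apply Cmod_series_term. }
    exists S. split; [exact hS|]. now apply Mellin_Bernstein_interp.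
  - intros a b hab.
    assert (H : forall k (p : R * R), k <> 0%Z -> strip a b p ->
      Cmod (RtoC (Rpower (fst p) c) * series_term c T f k (fst p) (snd p))
      (* On the strip [|t|] is at most the larger of [|a|] and [|b|], so one majorant serves all its
         points, whatever [r]. *)
      <= Cf * exp (T * Rmax (Rabs a) (Rabs b)) / IZR k ^ 2).
    { intros k [r t] hk [hr ht]. simpl in *.
      rewrite Cmod_mult, Cmod_R, Rabs_right by (left; apply exp_pos).
      eapply Rle_trans; [apply (Cmod_series_term (Cf := Cf)); assumption|].
      assert (IZR k <> 0) by now apply not_0_IZR.
      apply Rmult_le_compat_r.
      { left. apply Rinv_0_lt_compat. nra. }
      apply Rmult_le_compat_l; [lra|]. apply exp_le_compat.
      apply Rmult_le_compat_l; [lra|]. apply RmaxAbs; lra. }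
    split; [exact (zseries_cv_abs H)|exact (zseries_cv_unif H)].
Qed.
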